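(* For any $a\in\mathbb{C}\setminus\mathbb{Z}$ and any non-negative integers $k,\ell$, the following identity holds in a neighbourhood of $z=0$: $$(1-z)^{-a}\,F^{2:1;1}_{1:1;1}\!\left(\left.{a;\,-a-2k-2\ell;\,-k,-\ell \atop \frac12-k-\ell;\,-2k,-2\ell}\right|\frac{z}{z-1},\frac{1}{1-z}\right)$$ $$=\frac{\left(\frac{a+1}2\right)_\ell\left(\frac{a+1}2+k\right)_\ell}{\left(\frac12\right)_\ell\left(k+\frac12\right)_\ell}\;{}_2F_1\!\left(\left.{\frac a2,\,\frac{a+1}2+\ell\atop \frac12-k}\right|z\right)^2$$ $$-\frac{\left(\frac{a+1}2\right)_k\left(\frac{a+1}2+\ell\right)_k\left(\frac a2\right)_{k+\ell+1}^2}{\left(\frac12\right)_k\left(\frac12\right)_{k+1}^2\left(\frac12\right)_\ell\left(\frac12\right)_{k+\ell}}\;z^{2k+1}\;{}_2F_1\!\left(\left.{\frac{a+1}2+k,\,\frac a2+k+\ell+1\atop \frac32+k}\right|z\right)^2 .$$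
   Context: $(x)_n=x(x+1)\cdots(x+n-1)$ is the Pochhammer symbol, with $(x)_0=1$. ${}_2F_1\!\left(\left.{A,B\atop C}\right|z\right)=\sum_{j\ge0}\frac{(A)_j(B)_j}{(C)_j\,j!}z^j$ is the Gauss hypergeometric series. The double hypergeometric series is $$F^{2:1;1}_{1:1;1}\!\left(\left.{a;b;u_1,u_2\atop c;v_1,v_2}\right|x,y\right)=\sum_{p\ge0}\sum_{q\ge0}\frac{(a)_{p+q}(b)_{p+q}(u_1)_p(u_2)_q}{(c)_{p+q}(v_1)_p(v_2)_q\,p!\,q!}x^py^q .$$ When $u_1=-k$, $u_2=-\ell$, $v_1=-2k$, $v_2=-2\ell$ with non-negative integers $k,\ell$, it is interpreted as the terminating (finite) sum over $0\le p\le k$, $0\le q\le\ell$. The power $(1-z)^{-a}$ is the branch equal to $1$ at $z=0$. *)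

(* Defs.v *)
From Stdlib Require Import Reals Lra Factorial.
From Coquelicot Require Import Coquelicot.

Open Scope C_scope.

Fixpoint poch (x : C) (n : nat) : C :=
  match n with
  | O => 1
  | S m => poch x m * (x + INR m)
  end.

(* Coquelicot's [Series] is real-valued; the sum of a complex series is taken
   componentwise.  Like [Series], it is only meaningful for convergent series. *)
Definition CSeries (u : nat -> C) : C :=
  (Series (fun n => Re (u n)), Series (fun n => Im (u n))).

Lemma sum_n_ReIm (u : nat -> C) (n : nat) :
  sum_n u n = (sum_n (fun m => Re (u m)) n, sum_n (fun m => Im (u m)) n) :> C.
Proof.
induction n as [|n IHn].
- now rewrite !sum_O; destruct (u O).
- now rewrite !sum_Sn, IHn; destruct (u (S n)).
Qed.

Lemma CSeries_unique (u : nat -> C) (s : C) : is_series u s -> CSeries u = s.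
Proof.
intros Hs.
assert (Hloc : filterlim (sum_n u) eventually
                 (@locally (prod_UniformSpace R_UniformSpace R_UniformSpace) s))
  by exact Hs.
destruct s as [x y]; unfold CSeries; f_equal; apply is_series_unique.
- intros P [e HP].
  assert (HQ : locally ((x, y) : R * R) (fun z => P (fst z))).
  { exists e; intros z [Hz _]; now apply HP. }
  generalize (Hloc _ HQ); unfold filtermap; apply filter_imp.
  now intros n; rewrite sum_n_ReIm.
- intros P [e HP].
  assert (HQ : locally ((x, y) : R * R) (fun z => P (snd z))).
  { exists e; intros z [_ Hz]; now apply HP. }
  generalize (Hloc _ HQ); unfold filtermap; apply filter_imp.
  now intros n; rewrite sum_n_ReIm.
Qed.

Definition hyp2F1 (A B D z : C) : C :=
  CSeries (fun j =>
    poch A j * poch B j / (poch D j * INR (fact j)) * z ^ j).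

Definition F211_term (a b u1 u2 c v1 v2 x y : C) (p q : nat) : C :=
  poch a (p + q) * poch b (p + q) * poch u1 p * poch u2 q
  / (poch c (p + q) * poch v1 p * poch v2 q * INR (fact p) * INR (fact q))
  * x ^ p * y ^ q.

(* The double series with [u1 = -k], [u2 = -l], [v1 = -2k], [v2 = -2l], read as
   the finite sum over [0 <= p <= k], [0 <= q <= l] ([sum_n] includes its upper
   bound).  The truncation is part of the meaning: for [p > 2k] the general term
   would be of the form 0/0. *)
Definition F211_terminating (a b c : C) (k l : nat) (x y : C) : C :=
  sum_n (fun p => sum_n (fun q =>
    F211_term a b (- INR k) (- INR l) c (- (2 * INR k)) (- (2 * INR l)) x y p q)
    l) k.

Definition Cexp (z : C) : C :=
  (exp (Re z) * cos (Im z), exp (Re z) * sin (Im z))%R.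

(* Principal logarithm, on the half-plane [0 < Re w] only, where the argument is
   [atan (Im w / Re w)]. *)
Definition Clog (w : C) : C := (ln (Cmod w), atan (Im w / Re w)).

Lemma Cexp_Clog (w : C) : (0 < Re w)%R -> Cexp (Clog w) = w.
Proof.
destruct w as [x y]; unfold Cexp, Clog; simpl; intros Hx.
assert (Hw : (x, y) <> RtoC 0) by (intros H; injection H; intros; lra).
pose proof (proj1 (Cmod_gt_0 _) Hw) as Hm.
rewrite exp_ln by exact Hm.
assert (E : Cmod (x, y) = (x * sqrt (1 + (y / x)²))%R).
{ transitivity (sqrt (x²) * sqrt (1 + (y / x)²))%R;
    [|now rewrite sqrt_Rsqr by lra].
  rewrite <- sqrt_mult_alt by apply Rle_0_sqr.
  unfold Cmod; simpl; f_equal; unfold Rsqr; field; lra. }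
assert (Hs : (0 < sqrt (1 + (y / x)²))%R).
{ apply sqrt_lt_R0; pose proof (Rle_0_sqr (y / x)); lra. }
rewrite cos_atan, sin_atan, E; f_equal; field; lra.
Qed.

Lemma Clog_1 : Clog 1 = 0.
Proof.
unfold Clog; rewrite Cmod_1, ln_1; simpl.
now rewrite Rdiv_0_l, atan_0.
Qed.

(* For [0 < Re w] (in particular for [w = 1 - z] with [z] near 0) this is the
   branch of [w ^ s] equal to 1 at [w = 1]. *)
Definition Cpower (w s : C) : C := Cexp (s * Clog w).

(* Main.v *)
Require Import Defs.
From Stdlib Require Import Reals Factorial Lra Lia FunctionalExtensionality.
From Coquelicot Require Import Coquelicot.

(** Put x = z / (z - 1), so that 1 / (1 - z) = 1 - x, and m = 2 k + 1.  Pfaff's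
    transformation turns both Gauss functions of z on the right into Gauss
    functions of x, and the powers of 1 - z which it produces are exactly
    (1 - z)^(-a) times what changes z^m into - x^m.  What remains is an identity
    between a polynomial in x and two squares,

      sum over p <= k, q <= l of w_pq x^p (1 - x)^q
        = alpha F(x)^2 + beta x^m G(x)^2,

    where F = 2F1(a/2, - a/2 - k - l; 1/2 - k; x), and x^(m/2) G is the other
    local solution at 0 of the hypergeometric equation of F.  It is an identity
    of formal power series, and it has three reasons.

    - Both sides satisfy the third order equation solved by the products of two
      solutions of the equation of F (its symmetric square).  For the right side
      this is [sym_square_of_square].  For the left side, [sym_square_F211], the
      operator multiplies x^p (1 - x)^q by a polynomial in p and q which is a
      combination of the coefficients of three summation relations that the
      weights w_pq satisfy.

    - The exponents of that equation at 0 are 0, m/2 and m, and m/2 is not an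
      integer.  A power series solution is therefore determined by its
      coefficients of x^0 and x^m ([sym_square_unique]), so the left side is
      alpha F^2 + gamma x^m G^2 for some constants.  At x = 0 the left side is a
      terminating 3F2 at 1, summed by Watson's theorem ([watson]); this is alpha.

    - To find gamma, consider the quadratic differential form [discr], which is
      a discriminant on the space of products of two solutions.  On
      alpha F^2 + gamma x^m G^2 it is 4 alpha gamma times the square of the
      Wronskian, that is alpha gamma m^2 x^m (1 - x)^(2 l + 1)
      ([discr_squares_monomial]).  On the left side its top coefficient only
      depends on the top coefficient of the polynomial, to which the single pair
      p = k, q = l contributes.  Comparing the two gives alpha gamma, hence
      gamma = beta, because alpha is not 0 when a is not an integer.

    The passage from power series to functions rests on one rearrangement lemma
    for double series ([sums_to_diagonal]).  It gives the Cauchy product, and it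
    gives Pfaff's transformation from the binomial series and the
    Chu-Vandermonde sum. *)

Open Scope C_scope.

(** * Finite sums of complex numbers *)

(** [sum_n] on [C] has the carrier of a canonical structure as its type; [ring]
    and [field] only find their structure when the equation is at type [C]. *)
Ltac as_C := match goal with |- @eq _ ?x ?y => change (@eq C x y) end.
Ltac cring := as_C; ring.

Lemma csum_Sn (f : nat -> C) n : sum_n f (S n) = sum_n f n + f (S n).
Proof. exact (sum_Sn f n). Qed.

Lemma csum_head (f : nat -> C) n :
  sum_n f (S n) = f O + sum_n (fun i => f (S i)) n.
Proof.
  induction n as [|n IH].
  - now rewrite csum_Sn, !sum_O.
  - rewrite csum_Sn, IH, csum_Sn; cring.
Qed.

Lemma csum_plus (f g : nat -> C) n :
  sum_n (fun i => f i + g i) n = sum_n f n + sum_n g n.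
Proof. exact (sum_n_plus f g n). Qed.

Lemma csum_mult_l (c : C) (f : nat -> C) n :
  sum_n (fun i => c * f i) n = c * sum_n f n.
Proof. exact (sum_n_mult_l c f n). Qed.

Lemma INR_S (n : nat) : RtoC (INR (S n)) = INR n + 1.
Proof. now rewrite S_INR, RtoC_plus. Qed.

(** * Formal power series *)

Declare Scope fps_scope.
Delimit Scope fps_scope with fps.

Definition fps := nat -> C.
Bind Scope fps_scope with fps.

Definition cst (c : C) : fps := fun n => match n with O => c | _ => 0 end.
Arguments cst c%_C_scope.
Definition X : fps := fun n => match n with 1%nat => 1 | _ => 0 end.
Definition fadd (u v : fps) : fps := fun n => u n + v n.
Definition fopp (u : fps) : fps := fun n => - u n.
Definition fsub (u v : fps) : fps := fun n => u n - v n.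
Definition fmul (u v : fps) : fps :=
  fun n => sum_n (fun i => u i * v (n - i)%nat) n.
(** The Euler operator x d/dx. *)
Definition theta (u : fps) : fps := fun n => INR n * u n.

Notation fzero := (cst 0).
Notation fone := (cst 1).
Infix "+" := fadd : fps_scope.
Infix "-" := fsub : fps_scope.
Infix "*" := fmul : fps_scope.
Notation "- u" := (fopp u) : fps_scope.

Lemma fmul_0 (u v : fps) : fmul u v O = u O * v O.
Proof. unfold fmul; now rewrite sum_O. Qed.

(** This recursion on the tail of the first factor is what makes associativity,
    commutativity and the Leibniz rule provable by plain induction on the index,
    without exchanging double sums. *)
Lemma fmul_S (u v : fps) n :
  fmul u v (S n) = u O * v (S n) + fmul (fun i => u (S i)) v n.
Proof. unfold fmul; now rewrite csum_head. Qed.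

Lemma fmul_addl (u v w : fps) : ((u + v) * w = u * w + v * w)%fps.
Proof.
  apply functional_extensionality; intros n; unfold fmul, fadd.
  rewrite <- csum_plus; apply sum_n_ext; intros i; cring.
Qed.

Lemma cst_mul_at (c : C) (u : fps) n : (cst c * u)%fps n = c * u n.
Proof.
  destruct n as [|n]; [now rewrite fmul_0|rewrite fmul_S].
  replace (fmul _ u n) with (RtoC 0); [simpl; ring|].
  symmetry; unfold fmul; rewrite (sum_n_ext _ (fun _ => 0 * 0)).
  - rewrite csum_mult_l; cring.
  - intros i; simpl; cring.
Qed.

Lemma fmul_scal (c : C) (u v : fps) n :
  fmul (fun i => c * u i) v n = c * fmul u v n.
Proof.
  unfold fmul; rewrite <- csum_mult_l; apply sum_n_ext; intros i; cring.
Qed.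

Lemma fmul_assoc_at n : forall u v w : fps, (u * (v * w))%fps n = (u * v * w)%fps n.
Proof.
  induction n as [|n IH]; intros u v w.
  - rewrite !fmul_0; cring.
  - rewrite !fmul_S, fmul_0.
    replace (fun i => (u * v)%fps (S i))
      with (fadd (fun i => u O * v (S i)) (fmul (fun i => u (S i)) v))
      by (apply functional_extensionality; intros i; now rewrite fmul_S).
    rewrite fmul_addl; unfold fadd at 1; rewrite fmul_scal, IH; cring.
Qed.

Lemma fmul_comm_at n : forall u v : fps, (u * v)%fps n = (v * u)%fps n.
Proof.
  assert (H : forall n (u v : fps),
    fmul u v (S n) = fmul u (fun i => v (S i)) n + u (S n) * v O).
  { intros m u v; unfold fmul; rewrite csum_Sn, Nat.sub_diag; f_equal.
    apply sum_n_ext_loc; intros i Hi.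
    now replace (S m - i)%nat with (S (m - i)) by lia. }
  induction n as [|n IH]; intros u v.
  - rewrite !fmul_0; cring.
  - rewrite fmul_S, H, IH; cring.
Qed.

Lemma fps_ring : ring_theory fzero fone fadd fmul fsub fopp eq.
Proof.
  constructor; intros; apply functional_extensionality; intros n;
    try (unfold fadd, fopp, fsub; destruct n; simpl; ring).
  - rewrite cst_mul_at; cring.
  - apply fmul_comm_at.
  - apply fmul_assoc_at.
  - now rewrite fmul_addl.
Qed.

Add Ring fps_ring : fps_ring.

Lemma cst_add (c d : C) : cst (c + d) = (cst c + cst d)%fps.
Proof. apply functional_extensionality; intros [|n]; unfold fadd; simpl; cring. Qed.

Lemma cst_sub (c d : C) : cst (c - d) = (cst c - cst d)%fps.
Proof. apply functional_extensionality; intros [|n]; unfold fsub; simpl; cring. Qed.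

Lemma cst_opp (c : C) : cst (- c) = (- cst c)%fps.
Proof. apply functional_extensionality; intros [|n]; unfold fopp; simpl; cring. Qed.

Lemma cst_mul (c d : C) : cst (c * d) = (cst c * cst d)%fps.
Proof.
  apply functional_extensionality; intros n; rewrite cst_mul_at.
  destruct n; simpl; cring.
Qed.

Lemma X_mul_0 (u : fps) : (X * u)%fps O = 0.
Proof. rewrite fmul_0; simpl; cring. Qed.

Lemma X_mul_S (u : fps) n : (X * u)%fps (S n) = u n.
Proof.
  rewrite fmul_S; change (fun i => X (S i)) with fone.
  rewrite cst_mul_at; simpl; cring.
Qed.

(** * Derivations and order of vanishing *)

Lemma theta_mul (u v : fps) : theta (u * v)%fps = (theta u * v + u * theta v)%fps.
Proof.
  apply functional_extensionality; intros n; revert u v.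
  induction n as [|n IH]; intros u v; unfold fadd.
  - rewrite !fmul_0; unfold theta; rewrite fmul_0; simpl; cring.
  - unfold theta at 1; rewrite !fmul_S.
    assert (E := IH (fun i => u (S i)) v); unfold theta at 1, fadd in E.
    replace (fun i => theta u (S i))
      with (fadd (theta (fun i => u (S i))) (fun i => u (S i))).
    + rewrite fmul_addl; unfold fadd.
      unfold theta at 1 3; simpl (INR 0).
      rewrite INR_S, Cmult_plus_distr_r, Cmult_plus_distr_l, E; cring.
    + apply functional_extensionality; intros i.
      unfold fadd, theta; rewrite INR_S; cring.
Qed.

Lemma theta_add (u v : fps) : theta (u + v)%fps = (theta u + theta v)%fps.
Proof.
  apply functional_extensionality; intros n; unfold theta, fadd; cring.
Qed.

Lemma theta_opp (u : fps) : theta (- u)%fps = (- theta u)%fps.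
Proof.
  apply functional_extensionality; intros n; unfold theta, fopp; cring.
Qed.

Lemma theta_cst (c : C) : theta (cst c) = fzero.
Proof.
  apply functional_extensionality; intros [|n]; unfold theta; simpl; cring.
Qed.

Lemma theta_X : theta X = X.
Proof.
  apply functional_extensionality; intros [|[|n]]; unfold theta; simpl; cring.
Qed.

Definition Y : fps := (fone - X)%fps.

(** The derivation x (1 - x) d/dx.  The hypergeometric equation in terms of it is
    monic with polynomial coefficients, and it multiplies x^p (1 - x)^q by a
    polynomial. *)
Definition del (u : fps) : fps := (Y * theta u)%fps.

Lemma del_add (u v : fps) : del (u + v)%fps = (del u + del v)%fps.
Proof. unfold del; rewrite theta_add; ring. Qed.

Lemma del_opp (u : fps) : del (- u)%fps = (- del u)%fps.
Proof. unfold del; rewrite theta_opp; ring. Qed.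

Lemma del_sub (u v : fps) : del (u - v)%fps = (del u - del v)%fps.
Proof.
  replace (u - v)%fps with (u + - v)%fps by ring.
  rewrite del_add, del_opp; ring.
Qed.

Lemma del_mul (u v : fps) : del (u * v)%fps = (del u * v + u * del v)%fps.
Proof. unfold del; rewrite theta_mul; ring. Qed.

Lemma del_cst (c : C) : del (cst c) = fzero.
Proof. unfold del; rewrite theta_cst; ring. Qed.

Lemma del_X : del X = (X * Y)%fps.
Proof. unfold del; rewrite theta_X; ring. Qed.

Lemma del_Y : del Y = (- (X * Y))%fps.
Proof. unfold Y at 1; rewrite del_sub, del_cst, del_X; ring. Qed.

Lemma del_0 (u : fps) : del u O = 0.
Proof. unfold del; rewrite fmul_0; unfold theta; simpl; cring. Qed.

#[local] Hint Rewrite del_add del_opp del_sub del_mul del_cst del_X del_Y : del.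

Fixpoint fpow (u : fps) (n : nat) : fps :=
  match n with O => fone | S m => (u * fpow u m)%fps end.

Lemma del_pow_X (n : nat) : del (fpow X n) = (cst (INR n) * Y * fpow X n)%fps.
Proof.
  induction n as [|n IH]; simpl fpow.
  - rewrite del_cst; simpl INR; ring.
  - rewrite del_mul, IH, del_X, INR_S, cst_add; ring.
Qed.

Lemma del_pow_Y (n : nat) : del (fpow Y n) = (- (cst (INR n) * X * fpow Y n))%fps.
Proof.
  induction n as [|n IH]; simpl fpow.
  - rewrite del_cst; simpl INR; ring.
  - rewrite del_mul, IH, del_Y, INR_S, cst_add; ring.
Qed.

Lemma pow_X_lt (u : fps) n i : (i < n)%nat -> (fpow X n * u)%fps i = 0.
Proof.
  revert i; induction n as [|n IH]; intros i Hi; [lia|]; simpl fpow.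
  replace (X * fpow X n * u)%fps with (X * (fpow X n * u))%fps by ring.
  destruct i as [|i]; [apply X_mul_0|].
  rewrite X_mul_S; apply IH; lia.
Qed.

Lemma pow_X_ge (u : fps) n i : (fpow X n * u)%fps (n + i)%nat = u i.
Proof.
  induction n as [|n IH]; simpl fpow.
  - now replace (fone * u)%fps with u by ring.
  - replace (X * fpow X n * u)%fps with (X * (fpow X n * u))%fps by ring.
    now simpl Nat.add; rewrite X_mul_S.
Qed.

Lemma pow_X_at (u : fps) n : (fpow X n * u)%fps n = u O.
Proof. rewrite <- (pow_X_ge u n O); f_equal; lia. Qed.

Lemma pow_X_inj n (u v : fps) : (fpow X n * u = fpow X n * v)%fps -> u = v.
Proof.
  intros H; apply functional_extensionality; intros i.
  now rewrite <- (pow_X_ge u n i), <- (pow_X_ge v n i), H.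
Qed.

(** Every nonzero series is X^n v with v(0) <> 0; a linear equation is shown to
    have no nonzero solution by looking at its lowest coefficient only. *)
Lemma fps_eq_0_by_order (u : fps) :
  (forall n v, u = (fpow X n * v)%fps -> v O = 0) -> u = fzero.
Proof.
  intros H.
  assert (Hlt : forall n i, (i < n)%nat -> u i = 0).
  { induction n as [|n IH]; intros i Hi; [lia|].
    destruct (Nat.eq_dec i n) as [->|Hne]; [|apply IH; lia].
    specialize (H n (fun j => u (n + j)%nat)); simpl in H.
    rewrite Nat.add_0_r in H; apply H.
    apply functional_extensionality; intros j.
    destruct (Nat.lt_ge_cases j n) as [Hj|Hj].
    - rewrite pow_X_lt, IH by lia; reflexivity.
    - replace j with (n + (j - n))%nat by lia; now rewrite pow_X_ge. }
  apply functional_extensionality; intros i.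
  rewrite (Hlt (S i) i) by lia; now destruct i.
Qed.

Lemma del_pow_X_mul n (v : fps) :
  del (fpow X n * v)%fps = (fpow X n * (cst (INR n) * Y * v + del v))%fps.
Proof. rewrite del_mul, del_pow_X; ring. Qed.

Lemma cst_at_0 c : cst c O = c. Proof. reflexivity. Qed.
Lemma X_at_0 : X O = 0. Proof. reflexivity. Qed.
Lemma Y_at_0 : Y O = 1. Proof. unfold Y, fsub; simpl; cring. Qed.
Lemma fadd_0 (u v : fps) : (u + v)%fps O = u O + v O. Proof. reflexivity. Qed.
Lemma fsub_0 (u v : fps) : (u - v)%fps O = u O - v O. Proof. reflexivity. Qed.
Lemma fopp_0 (u : fps) : (- u)%fps O = - u O. Proof. reflexivity. Qed.

#[local] Hint Rewrite fadd_0 fsub_0 fopp_0 fmul_0 del_0 X_at_0 Y_at_0 cst_at_0 : at0.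

Lemma INR_neq_0 n : n <> O -> RtoC (INR n) <> 0.
Proof. intros Hn H; apply RtoC_inj in H; now apply not_0_INR in Hn. Qed.

Lemma first_order_unique (c : C) (u : fps) :
  del u = (cst c * X * u)%fps -> u O = 0 -> u = fzero.
Proof.
  intros Hu H0; apply fps_eq_0_by_order; intros n v ->.
  destruct (Nat.eq_dec n 0) as [->|Hn].
  - simpl fpow in H0; autorewrite with at0 in H0; now rewrite Cmult_1_l in H0.
  - rewrite del_pow_X_mul in Hu.
    assert (E : (cst (INR n) * Y * v + del v = cst c * X * v)%fps)
      by (apply (pow_X_inj n); rewrite Hu; ring).
    apply (f_equal (fun w : fps => w O)) in E; autorewrite with at0 in E.
    replace (v O) with (/ INR n * (INR n * 1 * v O + 0))
      by (field; now apply INR_neq_0).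
    rewrite E; ring.
Qed.

(** * Symmetric squares and their discriminant *)

(** The equation satisfied by the products of two solutions of
    y'' + P y' + Q y = 0, where ' is [del].  Small integers are written as sums
    of [fone] because [ring] treats the values of [cst] as atoms. *)
Definition sym_square (P Q u : fps) : fps :=
  (del (del (del u)) + (fone + fone + fone) * P * del (del u)
   + ((fone + fone) * P * P + del P + (fone + fone + fone + fone) * Q) * del u
   + ((fone + fone + fone + fone) * P * Q + (fone + fone) * del Q) * u)%fps.

(** The equation for u that says that e u solves y'' + P y' + Q y = 0 when
    e' = sg e.  The factor e itself (here 1 or X^(m/2)) need not be a power
    series; only its square and its logarithmic derivative sg are. *)
Definition twisted_ode (P Q sg u : fps) : Prop :=
  del (del u) = (- ((sg + sg + P) * del u
    + (sg * sg + del sg + P * sg + Q) * u))%fps.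

Lemma sym_square_of_square (P Q sg e u : fps) :
  del e = ((sg + sg) * e)%fps -> twisted_ode P Q sg u ->
  sym_square P Q (e * (u * u))%fps = fzero.
Proof.
  unfold twisted_ode, sym_square; intros He Hu.
  repeat (autorewrite with del; rewrite ?He, ?Hu).
  ring.
Qed.

(** If y1, y2 solve y'' + P y' + Q y = 0, this form takes the value
    (4 ac - b^2) W^2 on a y1^2 + b y1 y2 + c y2^2, where W is the Wronskian of
    y1 and y2. *)
Definition discr (P Q u : fps) : fps :=
  ((fone + fone) * u * del (del u) - del u * del u + (fone + fone) * P * u * del u
   + (fone + fone + fone + fone) * Q * u * u)%fps.

(** The Wronskian of u and e v divided by e, where e' = sg e. *)
Definition wronsk (sg u v : fps) : fps := (u * (sg * v + del v) - v * del u)%fps.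

Lemma discr_squares (P Q sg e u v : fps) (al ga : C) :
  del e = ((sg + sg) * e)%fps ->
  twisted_ode P Q fzero u -> twisted_ode P Q sg v ->
  discr P Q (cst al * (u * u) + cst ga * (e * (v * v)))%fps
  = (cst (4 * al * ga) * (e * (wronsk sg u v * wronsk sg u v)))%fps.
Proof.
  unfold twisted_ode, discr, wronsk; intros He Hu Hv.
  replace (4 * al * ga) with ((1 + 1 + 1 + 1) * al * ga) by ring.
  rewrite !cst_mul, !cst_add.
  repeat (autorewrite with del; rewrite ?He, ?Hu, ?Hv).
  ring.
Qed.

Lemma del_wronsk (P Q sg u v : fps) :
  twisted_ode P Q fzero u -> twisted_ode P Q sg v ->
  del (wronsk sg u v) = (- ((P + sg) * wronsk sg u v))%fps.
Proof.
  unfold twisted_ode, wronsk; intros Hu Hv.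
  repeat (autorewrite with del; rewrite ?Hu, ?Hv).
  ring.
Qed.

(** * The hypergeometric equation *)

Definition hcoef (A B D : C) : fps :=
  fun n => poch A n * poch B n / (poch D n * INR (fact n)).

Arguments hcoef (A B D)%_C_scope _.

Lemma poch_neq_0 (D : C) n :
  (forall i, (i < n)%nat -> D + INR i <> 0) -> poch D n <> 0.
Proof.
  induction n as [|n IH]; simpl; intros HD.
  - apply C1_nz.
  - apply Cmult_neq_0; [apply IH; intros i Hi|]; apply HD; lia.
Qed.

Lemma fact_S_C n : RtoC (INR (fact (S n))) = (INR n + 1) * INR (fact n).
Proof.
  rewrite <- INR_S, <- RtoC_mult, <- mult_INR; f_equal.
Qed.

Lemma fact_neq_0_C n : RtoC (INR (fact n)) <> 0.
Proof. apply INR_neq_0, fact_neq_0. Qed.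

Lemma INR_S_neq_0 n : INR n + 1 <> 0.
Proof. rewrite <- INR_S; now apply INR_neq_0. Qed.

Lemma hcoef_S (A B D : C) n :
  (forall i, D + INR i <> 0) ->
  (INR n + 1) * (D + INR n) * hcoef A B D (S n)
  = (A + INR n) * (B + INR n) * hcoef A B D n.
Proof.
  intros HD; unfold hcoef; rewrite fact_S_C; simpl poch.
  field; repeat split; auto using fact_neq_0_C, INR_S_neq_0, poch_neq_0.
Qed.

Definition odeP (A B D : C) : fps := (cst (D - 1) + (fone - cst (A + B)) * X)%fps.
Definition odeQ (A B : C) : fps := (- (cst (A * B) * X * Y))%fps.

Arguments odeP (A B D)%_C_scope.
Arguments odeQ (A B)%_C_scope.

(** The two-term recurrence of the coefficients is the equation
    theta (theta + D - 1) F = X (theta + A) (theta + B) F; multiplying it by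
    1 - X and rewriting theta through [del] gives the stated form. *)
Lemma hyp_ode (A B D : C) :
  (forall i, D + INR i <> 0) ->
  twisted_ode (odeP A B D) (odeQ A B) fzero (hcoef A B D).
Proof.
  intros HD; set (F := hcoef A B D).
  assert (H : (theta (theta F) + cst (D - 1) * theta F
    = X * (theta (theta F) + cst (A + B) * theta F + cst (A * B) * F))%fps).
  { apply functional_extensionality; intros [|n].
    - rewrite X_mul_0, fadd_0, cst_mul_at; unfold theta; simpl INR; cring.
    - rewrite X_mul_S; unfold fadd; rewrite !cst_mul_at; unfold theta.
      rewrite INR_S.
      transitivity ((INR n + 1) * (D + INR n) * F (S n)); [cring|].
      unfold F; rewrite (hcoef_S A B D n HD); cring. }
  unfold twisted_ode, odeP, odeQ; rewrite del_cst.
  replace (del (del F)) with (Y * (Y * theta (theta F) - X * theta F))%fps.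
  2:{ unfold del; rewrite theta_mul.
      replace (theta Y) with (- X)%fps; [ring|].
      unfold Y.
      replace (fone - X)%fps with (fone + - X)%fps by ring.
      rewrite theta_add, theta_cst, theta_opp, theta_X; ring. }
  replace (Y * (Y * theta (theta F) - X * theta F))%fps with
    (Y * ((theta (theta F) + cst (D - 1) * theta F)
      - X * theta (theta F) - X * theta F - cst (D - 1) * theta F))%fps
    by (unfold Y; ring).
  rewrite H; unfold del; ring.
Qed.

(** X^(1 - D) times this series is the second local solution at 0. *)
Lemma hyp_ode_second (A B D : C) :
  (forall i, 1 + (1 - D) + INR i <> 0) ->
  twisted_ode (odeP A B D) (odeQ A B) (cst (1 - D) * Y)%fps
    (hcoef (A + (1 - D)) (B + (1 - D)) (1 + (1 - D))).
Proof.
  intros HD; assert (H := hyp_ode (A + (1 - D)) (B + (1 - D)) _ HD).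
  revert H; set (G := hcoef _ _ _); unfold twisted_ode; intros ->.
  autorewrite with del; unfold odeP, odeQ, Y.
  replace ((A + (1 - D)) * (B + (1 - D)))
    with (A * B + A * (1 - D) + B * (1 - D) + (1 - D) * (1 - D)) by ring.
  repeat rewrite ?cst_sub, ?cst_add, ?cst_mul; ring.
Qed.

(** The indicial polynomial at 0 is n (n + D - 1) (n + 2 (D - 1)), with roots 0,
    m/2 and m; so the lowest coefficient of a power series solution sits in
    degree 0 or m. *)
Lemma sym_square_unique (A B D : C) (m : nat) (u : fps) :
  1 - D = INR m / 2 ->
  sym_square (odeP A B D) (odeQ A B) u = fzero ->
  u O = 0 -> u m = 0 ->
  (forall n, INR n + (D - 1) <> 0) -> u = fzero.
Proof.
  intros HD HL H0 Hm Hhalf; apply fps_eq_0_by_order; intros n v Hu.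
  destruct (Nat.eq_dec n 0) as [->|Hn0];
    [|destruct (Nat.eq_dec n m) as [->|Hnm]].
  - now rewrite <- H0, Hu, pow_X_at.
  - now rewrite <- Hm, Hu, pow_X_at.
  - assert (Hr : INR n * (INR n + (D - 1)) * (INR n + 2 * (D - 1)) <> 0).
    { apply Cmult_neq_0; [apply Cmult_neq_0|]; auto using INR_neq_0.
      replace (2 * (D - 1)) with (- INR m)
        by (replace (D - 1) with (- (1 - D)) by ring; rewrite HD; field).
      intros H; apply Hnm, INR_eq, RtoC_inj.
      replace (RtoC (INR n)) with (INR n + - INR m + INR m) by ring.
      rewrite H; ring. }
    (* del (X^n w) = X^n (tw w) *)
    pose (tw w := (cst (INR n) * Y * w + del w)%fps).
    pose (P := odeP A B D); pose (Q := odeQ A B).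
    assert (E : sym_square P Q u
      = (fpow X n * (tw (tw (tw v)) + (fone + fone + fone) * P * tw (tw v)
          + ((fone + fone) * P * P + del P + (fone + fone + fone + fone) * Q) * tw v
          + ((fone + fone + fone + fone) * P * Q + (fone + fone) * del Q) * v))%fps).
    { unfold sym_square; rewrite Hu, !del_pow_X_mul; unfold tw; ring. }
    unfold P, Q, tw in E; clear P Q tw.
    rewrite HL in E.
    apply (f_equal (fun w : fps => w n)) in E; rewrite pow_X_at in E.
    autorewrite with at0 in E; unfold odeP, odeQ in E; autorewrite with at0 in E.
    destruct (Ceq_dec (v O) 0) as [|Hv]; [assumption|exfalso].
    apply (Cmult_neq_0 _ _ Hr Hv).
    transitivity (fzero n); [rewrite E; cring|now destruct n].
Qed.

(** * The double sum and its differential equation *)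

Fixpoint fsum (f : nat -> fps) (n : nat) : fps :=
  match n with O => f O | S m => (fsum f m + f (S m))%fps end.

Lemma fsum_ext f g n :
  (forall i, (i <= n)%nat -> f i = g i) -> fsum f n = fsum g n.
Proof.
  induction n as [|n IH]; intros H; simpl; [now apply H|].
  rewrite IH, H; [reflexivity|lia|intros i Hi; apply H; lia].
Qed.

Lemma fsum_add f g n : fsum (fun i => f i + g i)%fps n = (fsum f n + fsum g n)%fps.
Proof. induction n as [|n IH]; simpl; [|rewrite IH]; ring. Qed.

Lemma fsum_mul (c : fps) f n : fsum (fun i => c * f i)%fps n = (c * fsum f n)%fps.
Proof. induction n as [|n IH]; simpl; [|rewrite IH]; ring. Qed.

Definition fsum2 (f : nat -> nat -> fps) (k l : nat) : fps :=
  fsum (fun p => fsum (f p) l) k.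

Lemma fsum2_ext f g k l :
  (forall p q, (p <= k)%nat -> (q <= l)%nat -> f p q = g p q) ->
  fsum2 f k l = fsum2 g k l.
Proof. intros H; apply fsum_ext; intros p Hp; apply fsum_ext; auto. Qed.

Lemma fsum2_add f g k l :
  fsum2 (fun p q => f p q + g p q)%fps k l = (fsum2 f k l + fsum2 g k l)%fps.
Proof.
  unfold fsum2; rewrite <- fsum_add; apply fsum_ext; intros; apply fsum_add.
Qed.

Lemma fsum2_mul c f k l :
  fsum2 (fun p q => c * f p q)%fps k l = (c * fsum2 f k l)%fps.
Proof.
  unfold fsum2; rewrite <- fsum_mul; apply fsum_ext; intros; apply fsum_mul.
Qed.

Lemma fsum2_exchange (f : nat -> nat -> fps) k l :
  fsum2 f k l = fsum2 (fun q p => f p q) l k.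
Proof.
  unfold fsum2; induction k as [|k IH]; simpl; [reflexivity|].
  now rewrite IH, <- fsum_add.
Qed.

(** All three relations between the weights come from this shift of the summation
    index: f vanishes below the range and g at its end, which is what the
    factors p and p - k of the coefficients achieve. *)
Lemma fsum_shift f g n :
  f O = fzero -> g n = fzero ->
  (forall i, (i < n)%nat -> f (S i) = g i) -> fsum f n = fsum g n.
Proof.
  intros H0 Hn HS; destruct n as [|n]; simpl; [congruence|].
  rewrite Hn.
  assert (H : forall j, (j <= n)%nat -> (fsum f j + f (S j))%fps = fsum g j).
  { induction j as [|j IH]; intros Hj; simpl.
    - rewrite H0, HS by lia; ring.
    - rewrite IH by lia; now rewrite HS by lia. }
  rewrite H by lia; ring.
Qed.

(** The coefficients of 1F1(-k; -2k; y) cut off after y^k, a Bessel polynomial up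
    to scaling.  They are 0 for p > k, also where the denominator vanishes. *)
Definition bessel_coef (k p : nat) : C :=
  poch (- INR k) p / (poch (- (2 * INR k)) p * INR (fact p)).

Lemma poch_neg_zero k p : (k < p)%nat -> poch (- INR k) p = 0.
Proof.
  induction p as [|p IH]; intros Hp; [lia|]; simpl.
  destruct (Nat.eq_dec k p) as [->|Hne]; [ring|].
  rewrite IH by lia; ring.
Qed.

Lemma INR_sub_neq_0 (i j : nat) : i <> j -> - INR i + INR j <> 0.
Proof.
  intros Hij H; apply Hij, INR_eq, RtoC_inj.
  replace (RtoC (INR i)) with (INR i + (- INR i + INR j)) by (rewrite H; ring).
  ring.
Qed.

Lemma poch_neg_neq_0 k p : (p <= k)%nat -> poch (- INR k) p <> 0.
Proof.
  intros Hp; apply poch_neq_0; intros i Hi; apply INR_sub_neq_0; lia.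
Qed.

Lemma INR_double k : 2 * INR k = INR (2 * k).
Proof. rewrite mult_INR, RtoC_mult; reflexivity. Qed.

Lemma bessel_coef_gt k p : (k < p)%nat -> bessel_coef k p = 0.
Proof.
  intros Hp; unfold bessel_coef; rewrite poch_neg_zero by assumption.
  unfold Cdiv; ring.
Qed.

Lemma bessel_coef_S k p :
  (INR p + 1) * (INR p - 2 * INR k) * bessel_coef k (S p) = (INR p - INR k) * bessel_coef k p.
Proof.
  destruct (Nat.lt_ge_cases p k) as [Hp|Hp].
  - unfold bessel_coef; rewrite fact_S_C; simpl poch.
    assert (H1 : poch (- (2 * INR k)) p <> 0)
      by (rewrite INR_double; apply poch_neg_neq_0; lia).
    assert (H2 : - (2 * INR k) + INR p <> 0)
      by (rewrite INR_double; apply INR_sub_neq_0; lia).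
    field; repeat split; auto using fact_neq_0_C, INR_S_neq_0.
  - rewrite (bessel_coef_gt k (S p)) by lia.
    destruct (Nat.eq_dec p k) as [->|]; [ring|].
    rewrite (bessel_coef_gt k p) by lia; ring.
Qed.

Definition central (a b c : C) (n : nat) : C := poch a n * poch b n / poch c n.

Lemma central_S a b c n :
  (forall i, c + INR i <> 0) ->
  (c + INR n) * central a b c (S n) = (a + INR n) * (b + INR n) * central a b c n.
Proof.
  intros Hc; unfold central; simpl poch; field; auto using poch_neq_0.
Qed.

Definition F211_mono (a b c : C) (k l p q : nat) : fps :=
  (cst (central a b c (p + q) * bessel_coef k p * bessel_coef l q) * (fpow X p * fpow Y q))%fps.

Definition F211_fps (a b c : C) (k l : nat) : fps :=
  fsum2 (F211_mono a b c k l) k l.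

Lemma sym_square_add P Q u v :
  sym_square P Q (u + v)%fps = (sym_square P Q u + sym_square P Q v)%fps.
Proof. unfold sym_square; rewrite !del_add; ring. Qed.

Lemma sym_square_cst P Q c u : sym_square P Q (cst c * u)%fps = (cst c * sym_square P Q u)%fps.
Proof.
  assert (H : forall v, del (cst c * v)%fps = (cst c * del v)%fps)
    by (intros v; rewrite del_mul, del_cst; ring).
  unfold sym_square; rewrite !H; ring.
Qed.

Lemma sym_square_fsum P Q f n : sym_square P Q (fsum f n) = fsum (fun i => sym_square P Q (f i)) n.
Proof. induction n as [|n IH]; simpl; [|rewrite sym_square_add, IH]; reflexivity. Qed.

Lemma sym_square_fsum2 P Q f k l :
  sym_square P Q (fsum2 f k l) = fsum2 (fun p q => sym_square P Q (f p q)) k l.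
Proof.
  unfold fsum2; rewrite sym_square_fsum; apply fsum_ext; intros; apply sym_square_fsum.
Qed.

Section Relations.

Context (a b c : C) (k l : nat) (Hc : forall i, c + INR i <> 0).
Let M := F211_mono a b c k l.

(** Here and in [relation_q] the coefficient c + p + q - 1 clears the denominator of the
    ratio of two consecutive values of [central]. *)
Lemma relation_p :
  fsum2 (fun p q =>
    cst ((c + INR (p + q) - 1) * (INR p * (INR p - 1 - 2 * INR k))) * M p q)%fps k l
  = fsum2 (fun p q =>
    X * (cst ((a + INR (p + q)) * (b + INR (p + q)) * (INR p - INR k)) * M p q))%fps k l.
Proof.
  rewrite !(fsum2_exchange _ k l); apply fsum_ext; intros q _; apply fsum_shift.
  - simpl INR. replace (_ * (0 * _)) with (RtoC 0) by ring. ring.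
  - replace (_ * (INR k - INR k)) with (RtoC 0) by ring; ring.
  - intros p _; unfold M, F211_mono; simpl fpow.
    transitivity (cst (((c + INR (p + q)) * central a b c (S (p + q)))
      * ((INR p + 1) * (INR p - 2 * INR k) * bessel_coef k (S p)) * bessel_coef l q)
      * (X * fpow X p * fpow Y q))%fps.
    + simpl Nat.add; rewrite !INR_S, !plus_INR, !RtoC_plus.
      repeat rewrite ?cst_mul, ?cst_sub, ?cst_add; ring.
    + rewrite (central_S a b c _ Hc), bessel_coef_S; rewrite !cst_mul; ring.
Qed.

Lemma relation_q :
  fsum2 (fun p q =>
    cst ((c + INR (p + q) - 1) * (INR q * (INR q - 1 - 2 * INR l))) * M p q)%fps k l
  = fsum2 (fun p q =>
    Y * (cst ((a + INR (p + q)) * (b + INR (p + q)) * (INR q - INR l)) * M p q))%fps k l.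
Proof.
  apply fsum_ext; intros p _; apply fsum_shift.
  - simpl INR. replace (_ * (0 * _)) with (RtoC 0) by ring. ring.
  - replace (_ * (INR l - INR l)) with (RtoC 0) by ring; ring.
  - intros q _; unfold M, F211_mono; simpl fpow.
    transitivity (cst (((c + INR (p + q)) * central a b c (S (p + q)))
      * ((INR q + 1) * (INR q - 2 * INR l) * bessel_coef l (S q)) * bessel_coef k p)
      * (Y * fpow X p * fpow Y q))%fps.
    + rewrite Nat.add_succ_r, !INR_S, !plus_INR, !RtoC_plus.
      repeat rewrite ?cst_mul, ?cst_sub, ?cst_add; ring.
    + rewrite (central_S a b c _ Hc), bessel_coef_S; rewrite !cst_mul; ring.
Qed.

(** The term (p + 1, q) on the left is the term (p, q + 1) on the right: both carry
    the central coefficient of index p + q + 1, so that no ratio of two values of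
    [central] enters. *)
Lemma relation_pq :
  fsum2 (fun p q =>
    Y * (cst (INR p * (INR p - 1 - 2 * INR k) * (INR q - INR l)) * M p q))%fps k l
  = fsum2 (fun p q =>
    X * (cst (INR q * (INR q - 1 - 2 * INR l) * (INR p - INR k)) * M p q))%fps k l.
Proof.
  pose (Om p q := (cst ((INR p - INR k) * bessel_coef k p * ((INR q - INR l) * bessel_coef l q)
    * central a b c (S (p + q))) * (fpow X (S p) * fpow Y (S q)))%fps).
  transitivity (fsum2 Om k l).
  - rewrite !(fsum2_exchange _ k l); apply fsum_ext; intros q _; apply fsum_shift.
    + simpl INR; replace (0 * _ * _) with (RtoC 0) by ring; ring.
    + unfold Om; replace ((INR k - INR k) * _ * _ * _) with (RtoC 0) by ring; ring.
    + intros p _; unfold Om, M, F211_mono; rewrite <- (bessel_coef_S k p); simpl fpow.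
      simpl Nat.add; rewrite !INR_S.
      repeat rewrite ?cst_mul, ?cst_sub, ?cst_add; ring.
  - apply fsum_ext; intros p _; symmetry; apply fsum_shift.
    + simpl INR; replace (0 * _ * _) with (RtoC 0) by ring; ring.
    + unfold Om; replace (_ * ((INR l - INR l) * _) * _) with (RtoC 0) by ring; ring.
    + intros q _; unfold Om, M, F211_mono; rewrite <- (bessel_coef_S l q); simpl fpow.
      rewrite Nat.add_succ_r, !INR_S.
      repeat rewrite ?cst_mul, ?cst_sub, ?cst_add; ring.
Qed.

End Relations.

Lemma fps_double_inj (u v : fps) : (u + u = v + v)%fps -> u = v.
Proof.
  intros H; apply functional_extensionality; intros n.
  apply (f_equal (fun w : fps => w n)) in H; unfold fadd in H.
  replace (u n) with ((u n + u n) / 2) by field; rewrite H; field.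
Qed.

Lemma INR_add (m n : nat) : RtoC (INR (m + n)) = INR m + INR n.
Proof. now rewrite plus_INR, RtoC_plus. Qed.

(** The operator multiplies every monomial x^p (1 - x)^q by a cubic polynomial in p
    and q, which the three relations reduce to 0.  Their multipliers Y^2, - X^2
    and - 1 are forced by the coefficients of p^3, q^3 and p^2 q. *)
Lemma sym_square_F211 (A b c : C) (k l : nat) :
  b = - (A + A) - 2 * INR k - 2 * INR l -> c = 1 / 2 - INR k - INR l ->
  (forall i, c + INR i <> 0) ->
  sym_square (odeP A (- A - INR k - INR l) (1 / 2 - INR k))
    (odeQ A (- A - INR k - INR l)) (F211_fps (A + A) b c k l) = fzero.
Proof.
  intros Hb Hceq Hc; unfold F211_fps; rewrite sym_square_fsum2.
  set (PP := odeP _ _ _); set (QQ := odeQ _ _).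
  set (M := F211_mono (A + A) b c k l).
  pose (ab p q := (A + A + INR (p + q)) * (b + INR (p + q))).
  pose (cn p q := c + INR (p + q) - 1).
  transitivity (fsum2 (fun p q =>
    (Y * Y) * (cst (cn p q * (INR p * (INR p - 1 - 2 * INR k))) * M p q)
    + (- (Y * Y)) * (X * (cst (ab p q * (INR p - INR k)) * M p q))
    + ((- (X * X)) * (cst (cn p q * (INR q * (INR q - 1 - 2 * INR l))) * M p q)
      + (X * X) * (Y * (cst (ab p q * (INR q - INR l)) * M p q)))
    + ((- fone) * (Y * (cst (INR p * (INR p - 1 - 2 * INR k) * (INR q - INR l)) * M p q))
      + X * (cst (INR q * (INR q - 1 - 2 * INR l) * (INR p - INR k)) * M p q)))%fps k l).
  - apply fsum2_ext; intros p q _ _.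
    unfold M, F211_mono; rewrite !sym_square_cst.
    set (w := cst (_ * _ * _)); set (W := (fpow X p * fpow Y q)%fps).
    assert (HW : del W = ((cst (INR p) * Y - cst (INR q) * X) * W)%fps)
      by (unfold W; rewrite del_mul, del_pow_X, del_pow_Y; ring).
    assert (HP : (PP + PP = (fone + fone + cst (INR k) + cst (INR k)
        + cst (INR l) + cst (INR l)) * X - (fone + cst (INR k) + cst (INR k)))%fps).
    { unfold PP, odeP.
      replace (1 / 2 - INR k - 1) with (- (1 / 2) - INR k) by field.
      replace (A + (- A - INR k - INR l)) with (- (INR k + INR l)) by ring.
      rewrite !cst_sub, !cst_opp, cst_add.
      replace fone with (cst (1 / 2) + cst (1 / 2))%fps at 5
        by (rewrite <- cst_add; f_equal; field).
      ring. }
    set (cc := cst (cn p q)).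
    assert (Hcc : (cc + cc = cst (INR p) + cst (INR p) + cst (INR q) + cst (INR q)
      - cst (INR k) - cst (INR k) - cst (INR l) - cst (INR l) - fone)%fps).
    { unfold cc, cn; replace (c + INR (p + q) - 1)
        with (INR p + INR q - INR k - INR l - 1 / 2) by (rewrite Hceq, INR_add; field).
      rewrite !cst_sub, !cst_add.
      replace fone with (cst (1 / 2) + cst (1 / 2))%fps
        by (rewrite <- cst_add; f_equal; field).
      ring. }
    (* [ring] knows no 1/2: both sides are doubled, so that only 2 PP and 2 cc,
       which have integral coefficients, occur. *)
    apply fps_double_inj.
    transitivity (w * ((fone + fone) * del (del (del W))
      + (fone + fone + fone) * (PP + PP) * del (del W)
      + ((PP + PP) * (PP + PP) + del (PP + PP)
        + (fone + fone) * (fone + fone) * (fone + fone) * QQ) * del W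
      + (fone + fone) * (fone + fone) * ((PP + PP) * QQ + del QQ) * W))%fps.
    { unfold sym_square; rewrite del_add; ring. }
    rewrite HP; unfold QQ, odeQ.
    repeat (autorewrite with del; rewrite ?HW).
    rewrite !(cst_mul (cn p q)); fold cc.
    transitivity ((fone + fone) * (- (Y * Y) * (X * (cst (ab p q * (INR p - INR k)) * (w * W)))
      + X * X * (Y * (cst (ab p q * (INR q - INR l)) * (w * W)))
      - Y * (cst (INR p * (INR p - 1 - 2 * INR k) * (INR q - INR l)) * (w * W))
      + X * (cst (INR q * (INR q - 1 - 2 * INR l) * (INR p - INR k)) * (w * W)))
      + (cc + cc) * (Y * Y * cst (INR p * (INR p - 1 - 2 * INR k))
         - X * X * cst (INR q * (INR q - 1 - 2 * INR l))) * (w * W))%fps; [|ring].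
    unfold ab; rewrite Hcc, INR_add, Hb.
    replace (RtoC 2) with (1 + 1) by ring.
    repeat rewrite ?cst_mul, ?cst_sub, ?cst_add, ?cst_opp.
    clearbody w W; unfold Y.
    ring.
  - unfold ab, cn; rewrite !fsum2_add, !fsum2_mul; unfold M.
    assert (R1 := relation_p (A + A) b c k l Hc).
    assert (R2 := relation_q (A + A) b c k l Hc).
    assert (R3 := relation_pq (A + A) b c k l).
    rewrite fsum2_mul in R1, R2, R3; rewrite (fsum2_mul X) in R3; rewrite R1, R2, R3.
    ring.
Qed.

(** * Watson's sum *)

Lemma bessel_coef_0 k : bessel_coef k 0 = 1.
Proof. unfold bessel_coef; simpl; field; apply C1_nz. Qed.

Lemma central_0 a b c : central a b c 0 = 1.
Proof. unfold central; simpl; field; apply C1_nz. Qed.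

Lemma half_int_neq_0 (z : Z) : 1 / 2 + IZR z <> 0.
Proof.
  intros H.
  assert (E : RtoC (IZR (2 * z + 1)) = 0).
  { rewrite plus_IZR, mult_IZR, RtoC_plus, RtoC_mult.
    replace (RtoC 2 * IZR z + 1) with (2 * (1 / 2 + IZR z)) by field.
    rewrite H; ring. }
  apply RtoC_inj in E; apply eq_IZR in E; lia.
Qed.

Lemma half_nat_neq_0 (i j : nat) : 1 / 2 + INR i - INR j <> 0.
Proof.
  replace (1 / 2 + INR i - INR j) with (1 / 2 + IZR (Z.of_nat i - Z.of_nat j)).
  - apply half_int_neq_0.
  - rewrite minus_IZR, <- !INR_IZR_INZ, RtoC_minus; ring.
Qed.

Lemma central_denominator_neq_0 (k l i : nat) : 1 / 2 - INR k - INR l + INR i <> 0.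
Proof.
  replace (1 / 2 - INR k - INR l + INR i) with (1 / 2 + INR i - INR (k + l))
    by (rewrite INR_add; ring).
  apply half_nat_neq_0.
Qed.

Lemma C2_nz : RtoC 2 <> 0.
Proof. intros H; apply RtoC_inj in H; lra. Qed.

Lemma INR_odd_neq_0 l : 2 * INR l + 1 <> 0.
Proof. rewrite INR_double; apply INR_S_neq_0. Qed.

Lemma Ceq_of_sub (x y : C) : x - y = 0 -> x = y.
Proof. intros H; replace x with (x - y + y) by ring; rewrite H; ring. Qed.

Lemma Cmult_reg (x u v : C) : x <> 0 -> x * u = x * v -> u = v.
Proof.
  intros Hx H; replace u with (/ x * (x * u)) by (field; assumption).
  rewrite H; field; assumption.
Qed.

Lemma bessel_coef_succ l q : (q <= l)%nat ->
  2 * (2 * INR l + 1) * (INR l + 1 - INR q) * bessel_coef (S l) q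
  = (2 * INR l + 2 - INR q) * (2 * INR l + 1 - INR q) * bessel_coef l q.
Proof.
  induction q as [|q IH]; intros Hq.
  - rewrite !bessel_coef_0; simpl INR; ring.
  - assert (E := IH ltac:(lia)).
    assert (E1 := bessel_coef_S (S l) q); assert (E2 := bessel_coef_S l q).
    rewrite INR_S in *.
    assert (H1 : INR l + 1 - INR q <> 0).
    { replace (INR l + 1 - INR q) with (- INR q + INR (S l)) by (rewrite INR_S; ring).
      apply INR_sub_neq_0; lia. }
    assert (H2 : INR q - 2 * INR l <> 0).
    { replace (INR q - 2 * INR l) with (- INR (2 * l) + INR q)
        by (rewrite <- INR_double; ring).
      apply INR_sub_neq_0; lia. }
    assert (H3 : INR q - 2 * (INR l + 1) <> 0).
    { replace (INR q - 2 * (INR l + 1)) with (- INR (2 * S l) + INR q)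
        by (rewrite <- INR_double, INR_S; ring).
      apply INR_sub_neq_0; lia. }
    apply (Cmult_reg ((INR q + 1) * (INR q - 2 * (INR l + 1)) * (INR q - 2 * INR l)
      * (INR l + 1 - INR q))).
    { repeat apply Cmult_neq_0; auto using INR_S_neq_0. }
    transitivity ((INR q - 2 * INR l) * (INR l - INR q) * (INR q - (INR l + 1))
      * (2 * (2 * INR l + 1) * (INR l + 1 - INR q) * bessel_coef (S l) q)).
    { transitivity (2 * (2 * INR l + 1) * (INR l - INR q) * (INR q - 2 * INR l) * (INR l + 1 - INR q)
       * ((INR q + 1) * (INR q - 2 * (INR l + 1)) * bessel_coef (S l) (S q))); [ring|].
      rewrite E1; ring. }
    rewrite E.
    transitivity ((INR q - 2 * (INR l + 1)) * (INR l + 1 - INR q)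
      * (2 * INR l + 2 - (INR q + 1)) * (2 * INR l + 1 - (INR q + 1))
      * ((INR q + 1) * (INR q - 2 * INR l) * bessel_coef l (S q))); [rewrite E2; ring|ring].
Qed.

Lemma bessel_coef_diag l :
  2 * (2 * INR l + 1) * bessel_coef (S l) (S l) = bessel_coef l l.
Proof.
  assert (E1 := bessel_coef_S (S l) l); assert (E := bessel_coef_succ l l (le_n l)).
  rewrite INR_S in E1.
  assert (H2 : INR l + 2 <> 0)
    by (replace (INR l + 2) with (INR (S l) + 1) by (rewrite INR_S; ring); apply INR_S_neq_0).
  apply (Cmult_reg ((INR l + 1) * (INR l + 2))).
  { apply Cmult_neq_0; auto using INR_S_neq_0. }
  transitivity (- (2 * (2 * INR l + 1)) * ((INR l + 1) * (INR l - 2 * (INR l + 1)) * bessel_coef (S l) (S l)));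
    [ring|].
  rewrite E1.
  transitivity (2 * (2 * INR l + 1) * (INR l + 1 - INR l) * bessel_coef (S l) l); [ring|].
  rewrite E; ring.
Qed.

Lemma poch_S_left x n : poch x (S n) = x * poch (x + 1) n.
Proof.
  induction n as [|n IH]; [simpl; ring|].
  change (poch x (S (S n))) with (poch x (S n) * (x + INR (S n))).
  rewrite IH, INR_S; simpl; ring.
Qed.

(** Watson's theorem for the terminating 3F2 with parameters
    a, - a - 2 (k + l), - l.  The induction raises l and lowers k, which keeps
    the central coefficients fixed.  Then the difference between the summand for
    l + 1 and r times the summand for l, with r the ratio of the right sides,
    telescopes. *)
Lemma watson (a : C) (l : nat) : forall k : nat,
  sum_n (fun q => central a (- a - 2 * INR k - 2 * INR l) (1 / 2 - INR k - INR l) q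
    * bessel_coef l q) l
  = poch ((a + 1) / 2) l * poch ((a + 1) / 2 + INR k) l
    / (poch (1 / 2) l * poch (INR k + 1 / 2) l).
Proof.
  induction l as [|l IH]; intros k.
  - rewrite sum_O, central_0, bessel_coef_0; simpl poch; as_C; field; apply C1_nz.
  - assert (Hstep : forall b c, b = - a - 2 * INR (S k) - 2 * INR l ->
      c = 1 / 2 - INR (S k) - INR l ->
      sum_n (fun q => central a b c q * bessel_coef (S l) q) (S l)
      = (1 - a * b / (2 * (2 * INR l + 1) * (INR k + 1 / 2)))
        * sum_n (fun q => central a b c q * bessel_coef l q) l).
    { intros b c Hb Hc.
      assert (Hk : INR k + 1 / 2 <> 0).
      { replace (INR k + 1 / 2) with (1 / 2 + INR k - INR 0) by (simpl; ring).
        apply half_nat_neq_0. }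
      assert (Hodd := INR_odd_neq_0 l).
      assert (Hodd2 : INR k * 2 + 1 <> 0)
        by (rewrite Cmult_comm; apply INR_odd_neq_0).
      assert (Hci : forall i, c + INR i <> 0)
    by (intros i; rewrite Hc; apply central_denominator_neq_0).
      (* The telescoped sum up to j is ka (a + j) (b + j) times the summand j for l.
         The factors a + j and b + j raise the central coefficient by one index. *)
      set (ka := / (2 * (2 * INR l + 1) * (INR k + 1 / 2))).
      set (r := 1 - a * b / _).
      assert (Hr : r = 1 - ka * (a * b)) by (unfold r, ka; field; repeat split; auto using C2_nz).
      assert (T : forall j, (j <= l)%nat ->
        sum_n (fun q => central a b c q * bessel_coef (S l) q) j
        = r * sum_n (fun q => central a b c q * bessel_coef l q) j
          + ka * ((a + INR j) * (b + INR j) * central a b c j * bessel_coef l j)).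
      { induction j as [|j IHj]; intros Hj.
        - rewrite !sum_O, !central_0, !bessel_coef_0, Hr; simpl INR; as_C; ring.
        - rewrite !csum_Sn, IHj by lia.
          rewrite <- (central_S a b c j Hci).
          assert (E1 := bessel_coef_succ l (S j) Hj).
          assert (E2 := bessel_coef_S l j).
          apply Ceq_of_sub.
          transitivity (central a b c (S j) * (bessel_coef (S l) (S j) - r * bessel_coef l (S j)
            + ka * ((c + INR j) * bessel_coef l j
              - (a + INR (S j)) * (b + INR (S j)) * bessel_coef l (S j)))); [as_C; ring|].
          rewrite INR_S in *.
          assert (H1 : INR l - INR j <> 0).
          { replace (INR l - INR j) with (- INR j + INR l) by ring.
            apply INR_sub_neq_0; lia. }
          assert (F1 : bessel_coef (S l) (S j)
             = (2 * INR l + 2 - (INR j + 1)) * (2 * INR l + 1 - (INR j + 1)) * bessel_coef l (S j)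
             / (2 * (2 * INR l + 1) * (INR l - INR j))).
          { rewrite <- E1; field; repeat split; auto using C2_nz. }
          assert (F2 : bessel_coef l j
             = - ((INR j + 1) * (INR j - 2 * INR l) * bessel_coef l (S j)) / (INR l - INR j)).
          { rewrite E2; field; repeat split; auto using C2_nz. }
          rewrite F1, F2, Hr, Hc, Hb; unfold ka.
          as_C; field; repeat split; auto using C2_nz. }
      rewrite csum_Sn, T by lia.
      replace ((a + INR l) * (b + INR l) * central a b c l) with ((c + INR l) * central a b c (S l))
        by now rewrite central_S.
      replace (bessel_coef l l) with (2 * (2 * INR l + 1) * bessel_coef (S l) (S l)) by apply bessel_coef_diag.
      unfold ka; rewrite Hc, INR_S; as_C; field; repeat split; auto using C2_nz. }
    replace (- a - 2 * INR k - 2 * INR (S l)) with (- a - 2 * INR (S k) - 2 * INR l)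
      by (rewrite !INR_S; ring).
    replace (1 / 2 - INR k - INR (S l)) with (1 / 2 - INR (S k) - INR l)
      by (rewrite !INR_S; ring).
    rewrite (Hstep _ _ eq_refl eq_refl), IH.
    rewrite !(poch_S_left (_ + INR k)), (poch_S_left (INR k + 1 / 2)).
    replace (INR k + 1 / 2 + 1) with (INR (S k) + 1 / 2) by (rewrite INR_S; ring).
    replace ((a + 1) / 2 + INR k + 1) with ((a + 1) / 2 + INR (S k)) by (rewrite INR_S; ring).
    cbn [poch].
    assert (Hh : forall j i, INR j + 1 / 2 + INR i <> 0).
    { intros j i; replace (INR j + 1 / 2 + INR i) with (1 / 2 + INR (j + i) - INR 0)
        by (rewrite INR_add; simpl; ring).
      apply half_nat_neq_0. }
    assert (H1 : poch (1 / 2) l <> 0).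
    { apply poch_neq_0; intros i _.
      replace (1 / 2 + INR i) with (INR 0 + 1 / 2 + INR i) by (simpl; ring); apply Hh. }
    assert (H2 : poch (INR (S k) + 1 / 2) l <> 0) by (apply poch_neq_0; intros; apply Hh).
    assert (H3 : 1 + INR l * 2 <> 0)
      by (rewrite Cplus_comm, Cmult_comm; apply INR_odd_neq_0).
    assert (H4 : INR k * 2 + 1 <> 0) by (rewrite Cmult_comm; apply INR_odd_neq_0).
    rewrite INR_S in *; as_C; field. repeat split;  auto using C2_nz.
Qed.

(** * Top coefficients *)

(** Allowing c = 0 makes sums
    of polynomials of different degrees uniform. *)
Definition top_coef (u : fps) (n : nat) (c : C) : Prop :=
  u n = c /\ forall i, (n < i)%nat -> u i = 0.

Lemma top_lt u m n c : top_coef u m c -> (m < n)%nat -> top_coef u n 0.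
Proof.
  intros [_ H] Hm; split; [|intros i Hi]; apply H; lia.
Qed.

Lemma top_add u v n c d : top_coef u n c -> top_coef v n d -> top_coef (u + v)%fps n (c + d).
Proof.
  intros [H1 H2] [H3 H4]; unfold fadd; split.
  - now rewrite H1, H3.
  - intros i Hi; rewrite H2, H4 by assumption; ring.
Qed.

Lemma top_opp u n c : top_coef u n c -> top_coef (- u)%fps n (- c).
Proof.
  intros [H1 H2]; unfold fopp; split.
  - now rewrite H1.
  - intros i Hi; rewrite H2 by assumption; ring.
Qed.

Lemma top_mul u v m n c d :
  top_coef u m c -> top_coef v n d -> top_coef (u * v)%fps (m + n) (c * d).
Proof.
  revert u; induction m as [|m IH]; intros u [H1 H2] Hv.
  - replace u with (cst (u O)).
    + destruct Hv as [H3 H4]; split; simpl Nat.add.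
      * rewrite cst_mul_at, H1, H3; reflexivity.
      * intros i Hi; rewrite cst_mul_at, H4 by assumption; ring.
    + apply functional_extensionality; intros [|i]; [reflexivity|].
      symmetry; apply H2; lia.
  - assert (Hu : top_coef (fun i => u (S i)) m c).
    { split; [assumption|intros i Hi; apply H2; lia]. }
    destruct (IH _ Hu Hv) as [H3 H4]; destruct Hv as [H5 H6]; split.
    + simpl Nat.add; rewrite fmul_S, H3, H6 by lia; ring.
    + intros [|i] Hi; [lia|]; rewrite fmul_S, H4, H6 by lia; ring.
Qed.

Lemma top_cst c : top_coef (cst c) 0 c.
Proof. split; [reflexivity|]; intros [|i] Hi; [lia|reflexivity]. Qed.

Lemma top_X : top_coef X 1 1.
Proof. split; [reflexivity|]; intros [|[|i]] Hi; [lia|lia|reflexivity]. Qed.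

Lemma top_Y : top_coef Y 1 (- 1).
Proof.
  replace Y with (fone + - X)%fps by (unfold Y; ring).
  replace (RtoC (-1)) with (0 + - (1)) by ring.
  apply top_add; [apply (top_lt _ 0 _ 1); [apply top_cst|lia]|].
  apply top_opp, top_X.
Qed.

Lemma top_del u n c : top_coef u n c -> top_coef (del u) (S n) (- (INR n * c)).
Proof.
  intros [H1 H2]; unfold del.
  replace (- (INR n * c)) with (- 1 * (INR n * c)) by ring.
  apply (top_mul _ _ 1 n); [apply top_Y|]; unfold theta; split.
  - now rewrite H1.
  - intros i Hi; rewrite H2 by assumption; ring.
Qed.

Lemma top_pow u n c : top_coef u 1 c -> top_coef (fpow u n) n (c ^ n).
Proof.
  intros H; induction n as [|n IH]; [apply top_cst|].
  now apply (top_mul _ _ 1 n).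
Qed.

Lemma top_fsum f n d c :
  (forall i, (i < n)%nat -> top_coef (f i) d 0) -> top_coef (f n) d c -> top_coef (fsum f n) d c.
Proof.
  assert (H0 : forall j, (forall i, (i <= j)%nat -> top_coef (f i) d 0) -> top_coef (fsum f j) d 0).
  { induction j as [|j IH]; intros H; simpl; [now apply H|].
    replace (RtoC 0) with (0 + 0) by ring; apply top_add; [apply IH|]; intros; apply H; lia. }
  intros H Hn; destruct n as [|n]; simpl; [assumption|].
  replace c with (0 + c) by ring; apply top_add; [|assumption].
  apply H0; intros i Hi; apply H; lia.
Qed.

Lemma top_F211 a b c k l :
  top_coef (F211_fps a b c k l) (k + l)
    (central a b c (k + l) * bessel_coef k k * bessel_coef l l * (- 1) ^ l).
Proof.
  assert (T : forall p q, top_coef (F211_mono a b c k l p q) (p + q)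
    (central a b c (p + q) * bessel_coef k p * bessel_coef l q * (- 1) ^ q)).
  { intros p q; apply (top_mul _ _ 0); [apply top_cst|].
    replace ((- 1) ^ q) with (1 ^ p * (- 1) ^ q) by (rewrite Cpow_1_l; ring).
    apply top_mul; apply top_pow; [apply top_X|apply top_Y]. }
  unfold F211_fps, fsum2; apply top_fsum.
  - intros p Hp; apply top_fsum; [intros q Hq|]; (eapply top_lt; [apply T|lia]).
  - apply top_fsum; [intros q Hq; eapply top_lt; [apply T|lia]|apply T].
Qed.

(** Only products of the top coefficients of u, P and Q reach the degree 2 N + 2. *)
Lemma top_discr A B D N u c :
  A + B = - INR N -> top_coef u N c ->
  top_coef (discr (odeP A B D) (odeQ A B) u) (N + N + 2) (- (c * c * (INR N * INR N - 4 * (A * B)))).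
Proof.
  intros HAB Hu.
  assert (HP : top_coef (odeP A B D) 1 (1 + INR N)).
  { unfold odeP; replace (1 + INR N) with (0 + (1 - (A + B)) * 1) by (rewrite HAB; ring).
    apply top_add; [apply (top_lt _ 0 _ (D - 1)); [apply top_cst|lia]|].
    rewrite <- cst_sub; apply (top_mul _ _ 0 1); [apply top_cst|apply top_X]. }
  assert (HQ : top_coef (odeQ A B) 2 (A * B)).
  { unfold odeQ; replace (A * B) with (- (A * B * 1 * - 1)) at 2 by ring.
    apply top_opp, (top_mul _ _ 1 1); [|apply top_Y].
    apply (top_mul _ _ 0 1); [apply top_cst|apply top_X]. }
  assert (H1 := top_del _ _ _ Hu); assert (H2 := top_del _ _ _ H1).
  replace (discr (odeP A B D) (odeQ A B) u) with
    (cst 2 * (u * del (del u)) + - (del u * del u)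
     + cst 2 * (odeP A B D * (u * del u)) + cst 4 * (odeQ A B * (u * u)))%fps.
  2:{ unfold discr; replace (RtoC 4) with (1 + 1 + 1 + 1) by ring.
      replace (RtoC 2) with (1 + 1) by ring; rewrite !cst_add; ring. }
  rewrite INR_S in H2.
  assert (T1 := top_mul _ _ _ _ _ _ (top_cst 2) (top_mul _ _ _ _ _ _ Hu H2)).
  assert (T2 := top_opp _ _ _ (top_mul _ _ _ _ _ _ H1 H1)).
  assert (T3 := top_mul _ _ _ _ _ _ (top_cst 2)
    (top_mul _ _ _ _ _ _ HP (top_mul _ _ _ _ _ _ Hu H1))).
  assert (T4 := top_mul _ _ _ _ _ _ (top_cst 4)
    (top_mul _ _ _ _ _ _ HQ (top_mul _ _ _ _ _ _ Hu Hu))).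
  replace (0 + (N + S (S N)))%nat with (N + N + 2)%nat in T1 by lia.
  replace (S N + S N)%nat with (N + N + 2)%nat in T2 by lia.
  replace (0 + (1 + (N + S N)))%nat with (N + N + 2)%nat in T3 by lia.
  replace (0 + (2 + (N + N)))%nat with (N + N + 2)%nat in T4 by lia.
  assert (T := top_add _ _ _ _ _ (top_add _ _ _ _ _ (top_add _ _ _ _ _ T1 T2) T3) T4).
  match type of T with top_coef _ _ ?e =>
    replace (- (c * c * (INR N * INR N - 4 * (A * B)))) with e by ring end.
  exact T.
Qed.

Lemma fsum_at f n i : fsum f n i = sum_n (fun j => f j i) n.
Proof.
  induction n as [|n IH]; [now rewrite sum_O|].
  rewrite csum_Sn, <- IH; reflexivity.
Qed.

Lemma pow_Y_at_0 n : fpow Y n O = 1.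
Proof.
  induction n as [|n IH]; [reflexivity|]; simpl fpow.
  rewrite fmul_0, IH, Y_at_0; ring.
Qed.

Lemma F211_fps_0 a b c k l :
  F211_fps a b c k l O = sum_n (fun q => central a b c q * bessel_coef l q) l.
Proof.
  assert (H : forall n, fsum (fun p => fsum (F211_mono a b c k l p) l) n O
    = fsum (F211_mono a b c k l O) l O).
  { induction n as [|n IH]; [reflexivity|]; simpl fsum; rewrite fadd_0, IH.
    replace (fsum (F211_mono a b c k l (S n)) l O) with (RtoC 0); [ring|symmetry].
    rewrite fsum_at.
    rewrite (sum_n_ext _ (fun _ => 0 * 0)); [rewrite csum_mult_l; cring|].
    intros q; unfold F211_mono; simpl fpow; rewrite !fmul_0; simpl; cring. }
  unfold F211_fps, fsum2; rewrite H, fsum_at; apply sum_n_ext; intros q.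
  unfold F211_mono; simpl fpow; simpl Nat.add.
  rewrite !fmul_0, pow_Y_at_0, bessel_coef_0; simpl; cring.
Qed.

(** * The double sum as a combination of two squares *)

(** With om the Wronskian of F and X^(m/2) G divided by X^(m/2), Abel's formula is
    the first order equation om' = - (l + 1/2) X om.  Hence om^2 and
    (m/2)^2 Y^(2 l + 1) solve the same equation and have the same value at 0. *)
Lemma discr_squares_monomial (A B : C) (k l : nat) (al ga : C) (F G : fps) :
  let D := 1 / 2 - INR k in
  A + B = - INR (k + l) ->
  twisted_ode (odeP A B D) (odeQ A B) fzero F ->
  twisted_ode (odeP A B D) (odeQ A B) (cst (1 - D) * Y)%fps G ->
  F O = 1 -> G O = 1 ->
  discr (odeP A B D) (odeQ A B)
    (cst al * (F * F) + cst ga * (fpow X (2 * k + 1) * (G * G)))%fps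
  = (cst (al * ga * INR (2 * k + 1) ^ 2) * (fpow X (2 * k + 1) * fpow Y (2 * l + 1)))%fps.
Proof.
  intros D HAB HF HG HF0 HG0.
  assert (Hm : INR (2 * k + 1) = (1 - D) + (1 - D) :> C).
  { rewrite INR_add, <- INR_double; unfold D; simpl INR; field. }
  rewrite (discr_squares _ _ (cst (1 - D) * Y)%fps);
    [|rewrite del_pow_X, Hm, cst_add; ring|assumption..].
  set (om := wronsk _ F G).
  assert (Hom : del om = (cst (- (INR l + 1 / 2)) * X * om)%fps).
  { unfold om; rewrite (del_wronsk _ _ _ _ _ HF HG); set (w := wronsk _ _ _).
    unfold odeP, Y.
    replace (A + B) with (- INR k - INR l) by (rewrite HAB, INR_add; ring).
    replace (D - 1) with (- (1 - D)) by ring.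
    replace (1 - D) with (INR k + 1 / 2) by (unfold D; field).
    repeat rewrite ?cst_mul, ?cst_sub, ?cst_add, ?cst_opp.
    replace fone with (cst (1 / 2) + cst (1 / 2))%fps at 1
      by (rewrite <- cst_add; f_equal; field).
    ring. }
  assert (H0 : (om * om - cst ((1 - D) * (1 - D)) * fpow Y (2 * l + 1))%fps = fzero).
  { apply (first_order_unique (- INR (2 * l + 1))).
    - rewrite del_sub, !del_mul, Hom, del_pow_Y, del_cst.
      rewrite INR_add, <- INR_double.
      replace (- (2 * INR l + INR 1)) with (- (INR l + 1 / 2) + - (INR l + 1 / 2))
        by (simpl INR; field).
      replace (2 * INR l + INR 1) with ((INR l + 1 / 2) + (INR l + 1 / 2))
        by (simpl INR; field).
      repeat rewrite ?cst_opp, ?cst_add; ring.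
    - rewrite fsub_0, !fmul_0, pow_Y_at_0; unfold om, wronsk.
      repeat rewrite ?fsub_0, ?fmul_0, ?fadd_0; rewrite !del_0, HF0, HG0, Y_at_0, !cst_at_0; ring. }
  replace (om * om)%fps with (cst ((1 - D) * (1 - D)) * fpow Y (2 * l + 1))%fps.
  - replace (al * ga * INR (2 * k + 1) ^ 2) with (4 * al * ga * ((1 - D) * (1 - D)))
      by (rewrite Hm; ring).
    rewrite (cst_mul (4 * al * ga)); ring.
  - replace (om * om)%fps with (om * om - cst ((1 - D) * (1 - D)) * fpow Y (2 * l + 1)
       + cst ((1 - D) * (1 - D)) * fpow Y (2 * l + 1))%fps by ring.
    rewrite H0; ring.
Qed.

Lemma hcoef_0 A B D : hcoef A B D O = 1.
Proof. unfold hcoef; simpl; field; apply C1_nz. Qed.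

(** The hypothesis on al * ga is the comparison of top coefficients of the two
    expressions for the discriminant. *)
Lemma F211_fps_squares (A b c : C) (k l : nat) (al ga : C) :
  b = - (A + A) - 2 * INR k - 2 * INR l -> c = 1 / 2 - INR k - INR l ->
  F211_fps (A + A) b c k l O = al -> al <> 0 ->
  al * ga * INR (2 * k + 1) ^ 2
    = (central (A + A) b c (k + l) * bessel_coef k k * bessel_coef l l * (A + A + INR k + INR l)) ^ 2 ->
  let F := hcoef A (- A - INR k - INR l) (1 / 2 - INR k) in
  let G := hcoef (A + (1 / 2 + INR k)) (1 / 2 - A - INR l) (3 / 2 + INR k) in
  F211_fps (A + A) b c k l
  = (cst al * (F * F) + cst ga * (fpow X (2 * k + 1) * (G * G)))%fps.
Proof.
  intros Hb Hc H0 Hal Hga F G.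
  assert (Hci : forall i, c + INR i <> 0)
    by (intros i; rewrite Hc; apply central_denominator_neq_0).
  set (B := - A - INR k - INR l) in *; set (D := 1 / 2 - INR k) in *.
  assert (HD1 : 1 - D = 1 / 2 + INR k) by (unfold D; field).
  assert (HAB : A + B = - INR (k + l)) by (unfold B; rewrite INR_add; ring).
  assert (HF : twisted_ode (odeP A B D) (odeQ A B) fzero F).
  { apply hyp_ode; intros i; unfold D.
    replace (1 / 2 - INR k + INR i) with (1 / 2 + INR i - INR k) by ring.
    apply half_nat_neq_0. }
  assert (HG : twisted_ode (odeP A B D) (odeQ A B) (cst (1 - D) * Y)%fps G).
  { unfold G.
    replace (A + (1 / 2 + INR k)) with (A + (1 - D)) by (rewrite HD1; ring).
    replace (1 / 2 - A - INR l) with (B + (1 - D)) by (rewrite HD1; unfold B; ring).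
    replace (3 / 2 + INR k) with (1 + (1 - D)) by (rewrite HD1; field).
    apply hyp_ode_second; intros i; rewrite HD1.
    replace (1 + (1 / 2 + INR k) + INR i) with (1 / 2 + INR (1 + k + i) - INR 0)
      by (rewrite !INR_add; simpl INR; ring).
    apply half_nat_neq_0. }
  assert (HL := sym_square_F211 A b c k l Hb Hc Hci); fold B D in HL.
  set (U := F211_fps _ _ _ _ _) in *; set (m := (2 * k + 1)%nat) in *.
  (* The value which makes both sides agree in degree m. *)
  set (ga' := U m - al * (F * F)%fps m).
  assert (HR : U = (cst al * (F * F) + cst ga' * (fpow X m * (G * G)))%fps).
  { set (R := (_ + _)%fps).
    assert (HS : (U - R)%fps = fzero).
    { apply (sym_square_unique A B D m).
      - rewrite HD1; unfold m; rewrite INR_add, <- INR_double; simpl INR; field.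
      - replace (U - R)%fps with (U + cst (- (1)) * R)%fps by (rewrite cst_opp; ring).
        rewrite sym_square_add, sym_square_cst, HL; unfold R.
        rewrite sym_square_add, !sym_square_cst.
        replace (F * F)%fps with (fone * (F * F))%fps by ring.
        rewrite (sym_square_of_square _ _ fzero fone F);
          [|rewrite del_cst; ring|assumption].
        rewrite (sym_square_of_square _ _ (cst (1 - D) * Y) (fpow X m) G)%fps; [ring| |assumption].
        rewrite del_pow_X.
        replace (RtoC (INR m)) with ((1 - D) + (1 - D)); [rewrite cst_add; ring|].
        rewrite HD1; unfold m; rewrite INR_add, <- INR_double; simpl INR; field.
      - unfold R; rewrite fsub_0, fadd_0, !cst_mul_at, H0, fmul_0.
        rewrite pow_X_lt by (unfold m; lia); unfold F; rewrite hcoef_0; ring.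
      - unfold fsub, R, fadd; rewrite !cst_mul_at, pow_X_at, fmul_0.
        unfold G; rewrite hcoef_0; unfold ga'; ring.
      - intros n; replace (INR n + (D - 1)) with (1 / 2 + INR n - INR (1 + k))
          by (unfold D; rewrite INR_add; simpl INR; field).
        apply half_nat_neq_0. }
    replace U with (U - R + R)%fps by ring; rewrite HS; ring. }
  assert (HT := top_discr A B D (k + l) U _ HAB (top_F211 (A + A) b c k l)).
  rewrite HR in HT at 1; unfold m in HT.
  assert (HM := discr_squares_monomial A B k l al ga' F G HAB HF HG
    (hcoef_0 _ _ _) (hcoef_0 _ _ _)).
  cbv zeta in HM; fold D in HM; rewrite HM in HT.
  assert (HT' : top_coef (cst (al * ga' * INR (2 * k + 1) ^ 2)
      * (fpow X (2 * k + 1) * fpow Y (2 * l + 1)))%fps (0 + ((2 * k + 1) + (2 * l + 1)))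
      (al * ga' * INR (2 * k + 1) ^ 2 * (1 ^ (2 * k + 1) * (-1) ^ (2 * l + 1)))).
  { apply top_mul; [apply top_cst|].
    apply top_mul; apply top_pow; [apply top_X|apply top_Y]. }
  destruct HT as [HT _]; destruct HT' as [HT' _].
  replace (0 + (2 * k + 1 + (2 * l + 1)))%nat with (k + l + (k + l) + 2)%nat in HT' by lia.
  rewrite HT in HT'; clear HT.
  assert (Hsq : (-1) ^ l * (-1) ^ l = 1).
  { rewrite <- Cpow_mult_l; replace (-1 * -1) with (RtoC 1) by ring; apply Cpow_1_l. }
  assert (Hodd : (-1) ^ (2 * l + 1) = -1).
  { rewrite Cpow_add_r; replace (2 * l)%nat with (l + l)%nat by lia.
    rewrite Cpow_add_r, Hsq, Cpow_1_r; ring. }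
  rewrite Cpow_1_l, Hodd in HT'.
  enough (E : ga' = ga) by now rewrite <- E.
  apply (Cmult_reg (al * INR (2 * k + 1) ^ 2)).
  { apply Cmult_neq_0; [assumption|apply Cpow_nz, INR_neq_0; lia]. }
  transitivity (- (al * ga' * INR (2 * k + 1) ^ 2 * (1 * -1))); [ring|].
  rewrite <- HT'.
  transitivity (al * ga * INR m ^ 2); [rewrite Hga|unfold m; ring].
  transitivity ((central (A + A) b c (k + l) * bessel_coef k k * bessel_coef l l) ^ 2 * ((-1) ^ l * (-1) ^ l)
    * (INR (k + l) * INR (k + l) - 4 * (A * B))); [ring|].
  rewrite Hsq, INR_add; unfold B; ring.
Qed.

(** * The two coefficients in closed form *)

Lemma poch_add x m n : poch x (m + n) = poch x m * poch (x + INR m) n.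
Proof.
  revert x; induction m as [|m IH]; intros x.
  - simpl; rewrite Cplus_0_r; ring.
  - simpl Nat.add; rewrite !poch_S_left, IH, INR_S.
    replace (x + 1 + INR m) with (x + (INR m + 1)) by ring; ring.
Qed.

Lemma poch_double x n : poch x (2 * n) = 4 ^ n * poch (x / 2) n * poch ((x + 1) / 2) n.
Proof.
  induction n as [|n IH]; [simpl; ring|].
  replace (2 * S n)%nat with (S (S (2 * n))) by lia.
  cbn [poch]; rewrite IH, INR_S, <- INR_double, Cpow_S; field.
Qed.

(** The product read backwards. *)
Lemma poch_reflect y n : poch (- y - INR n + 1) n = (-1) ^ n * poch y n.
Proof.
  induction n as [|n IH]; [simpl; ring|].
  rewrite poch_S_left, INR_S.
  replace (- y - (INR n + 1) + 1 + 1) with (- y - INR n + 1) by ring.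
  rewrite IH, Cpow_S; simpl poch; ring.
Qed.

Lemma bessel_coef_diag_closed l : 4 ^ l * poch (1 / 2) l * bessel_coef l l = 1.
Proof.
  induction l as [|l IH]; [rewrite bessel_coef_0; simpl; ring|].
  transitivity (4 ^ l * poch (1 / 2) l * bessel_coef l l); [|exact IH].
  rewrite <- (bessel_coef_diag l), Cpow_S; simpl poch; field.
Qed.

Lemma poch_half_neq_0 n : poch (1 / 2) n <> 0.
Proof.
  apply poch_neq_0; intros i _.
  replace (1 / 2 + INR i) with (1 / 2 + INR i - INR 0) by (simpl; ring).
  apply half_nat_neq_0.
Qed.

Definition alpha (a : C) (k l : nat) : C :=
  poch ((a + 1) / 2) l * poch ((a + 1) / 2 + INR k) l
  / (poch (1 / 2) l * poch (INR k + 1 / 2) l).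

Definition beta (a : C) (k l : nat) : C :=
  poch ((a + 1) / 2) k * poch ((a + 1) / 2 + INR l) k
  * poch (a / 2) (k + l + 1) ^ 2
  / (poch (1 / 2) k * poch (1 / 2) (k + 1) ^ 2 * poch (1 / 2) l
     * poch (1 / 2) (k + l)).

Lemma C4_pow_nz n : 4 ^ n <> 0.
Proof. apply Cpow_nz; intros H; apply RtoC_inj in H; lra. Qed.

(** With N = k + l, the numerator (a)_N (a + N) (a + N + 1)_N is (a)_(2 N + 1),
    which the duplication formula splits with a factor 4^N; the diagonal Bessel
    coefficients 1 / (4^k (1/2)_k) and 1 / (4^l (1/2)_l) cancel it. *)
Lemma F211_top_closed (a b c : C) (k l : nat) :
  b = - a - 2 * INR k - 2 * INR l -> c = 1 / 2 - INR k - INR l ->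
  central a b c (k + l) * bessel_coef k k * bessel_coef l l * (a + INR k + INR l)
  = 2 * poch (a / 2) (k + l + 1) * poch ((a + 1) / 2) (k + l)
    / (poch (1 / 2) (k + l) * poch (1 / 2) k * poch (1 / 2) l).
Proof.
  intros Hb Hc; set (N := (k + l)%nat).
  assert (HN : RtoC (INR N) = INR k + INR l) by apply INR_add.
  assert (E1 : poch b N = (-1) ^ N * poch (a + INR N + 1) N).
  { rewrite <- poch_reflect; f_equal; rewrite Hb, HN; ring. }
  assert (E2 : poch c N = (-1) ^ N * poch (1 / 2) N).
  { rewrite <- poch_reflect; f_equal; rewrite Hc, HN; field. }
  assert (E3 : poch a N * ((a + INR N) * poch (a + INR N + 1) N)
    = 4 ^ k * 4 ^ l * 2 * poch (a / 2) (N + 1) * poch ((a + 1) / 2) N).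
  { rewrite <- poch_S_left, <- poch_add.
    replace (N + S N)%nat with (S (2 * N)) by lia; cbn [poch].
    rewrite poch_double, <- INR_double, poch_add; unfold N; rewrite Cpow_add_r; simpl poch.
    simpl INR; field. }
  assert (Hk := bessel_coef_diag_closed k); assert (Hl := bessel_coef_diag_closed l).
  assert (Hs : (-1) ^ N <> 0)
    by (apply Cpow_nz; intros H; apply RtoC_inj in H; lra).
  assert (P1 := poch_half_neq_0 N); assert (P2 := poch_half_neq_0 k);
    assert (P3 := poch_half_neq_0 l); assert (P4 := C4_pow_nz k);
    assert (P5 := C4_pow_nz l).
  replace (bessel_coef k k) with (/ (4 ^ k * poch (1 / 2) k)).
  2:{ apply (Cmult_reg (4 ^ k * poch (1 / 2) k)); [now apply Cmult_neq_0|].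
      rewrite Hk; field; auto. }
  replace (bessel_coef l l) with (/ (4 ^ l * poch (1 / 2) l)).
  2:{ apply (Cmult_reg (4 ^ l * poch (1 / 2) l)); [now apply Cmult_neq_0|].
      rewrite Hl; field; auto. }
  unfold central; rewrite E1, E2.
  transitivity (poch a N * ((a + INR N) * poch (a + INR N + 1) N)
    / (poch (1 / 2) N * (4 ^ k * poch (1 / 2) k) * (4 ^ l * poch (1 / 2) l))).
  - rewrite HN; field; repeat split; assumption.
  - rewrite E3; field; repeat split; assumption.
Qed.

Lemma alpha_beta (a b c : C) (k l : nat) :
  b = - a - 2 * INR k - 2 * INR l -> c = 1 / 2 - INR k - INR l ->
  alpha a k l * beta a k l * INR (2 * k + 1) ^ 2
  = (central a b c (k + l) * bessel_coef k k * bessel_coef l l * (a + INR k + INR l)) ^ 2.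
Proof.
  intros Hb Hc; rewrite (F211_top_closed a b c k l Hb Hc).
  assert (P1 := poch_half_neq_0 (k + l)); assert (P2 := poch_half_neq_0 k);
    assert (P3 := poch_half_neq_0 l).
  assert (F1 : poch ((a + 1) / 2) k * poch ((a + 1) / 2 + INR k) l
    = poch ((a + 1) / 2) (k + l)) by now rewrite poch_add.
  assert (F2 : poch ((a + 1) / 2) l * poch ((a + 1) / 2 + INR l) k
    = poch ((a + 1) / 2) (k + l)) by now rewrite Nat.add_comm, poch_add.
  assert (F3 : poch (1 / 2) k * poch (INR k + 1 / 2) l = poch (1 / 2) (k + l))
    by now rewrite poch_add, (Cplus_comm (INR k)).
  assert (F4 : poch (1 / 2) (k + 1) = poch (1 / 2) k * INR (2 * k + 1) / 2).
  { rewrite Nat.add_1_r; simpl poch; rewrite INR_add, <- INR_double; simpl INR; field. }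
  assert (P4 : poch (INR k + 1 / 2) l <> 0).
  { intros H; rewrite H in F3; apply P1; rewrite <- F3; ring. }
  assert (P5 : RtoC (INR (2 * k + 1)) <> 0) by (apply INR_neq_0; lia).
  unfold alpha, beta; rewrite F4.
  transitivity (4 * (poch ((a + 1) / 2) k * poch ((a + 1) / 2 + INR k) l)
     * (poch ((a + 1) / 2) l * poch ((a + 1) / 2 + INR l) k)
     * poch (a / 2) (k + l + 1) ^ 2
     / ((poch (1 / 2) k * poch (INR k + 1 / 2) l) * poch (1 / 2) (k + l)
        * poch (1 / 2) k ^ 2 * poch (1 / 2) l ^ 2)).
  - field; repeat split; assumption.
  - rewrite F1, F2, F3; field; repeat split; assumption.
Qed.

Lemma alpha_neq_0 (a : C) (k l : nat) :
  (forall n : Z, a <> IZR n) -> alpha a k l <> 0.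
Proof.
  intros Ha.
  assert (H : forall j n, poch ((a + 1) / 2 + INR j) n <> 0).
  { intros j n; apply poch_neq_0; intros i _ E.
    apply (Ha (- (2 * Z.of_nat (j + i) + 1))%Z).
    rewrite opp_IZR, plus_IZR, mult_IZR, <- INR_IZR_INZ, RtoC_opp, RtoC_plus, RtoC_mult, INR_add.
    replace a with (2 * ((a + 1) / 2 + INR j + INR i) - 1 - 2 * INR j - 2 * INR i) by field.
    rewrite E; ring. }
  assert (P1 := poch_half_neq_0 l).
  assert (P4 : poch (INR k + 1 / 2) l <> 0).
  { intros E; apply (poch_half_neq_0 (k + l)).
    rewrite poch_add, (Cplus_comm (1 / 2)), E; ring. }
  assert (H0 := H O l); simpl INR in H0; rewrite Cplus_0_r in H0.
  intros E; apply (Cmult_neq_0 _ _ H0 (H k l)).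
  replace (_ * _) with (alpha a k l * (poch (1 / 2) l * poch (INR k + 1 / 2) l))
    by (unfold alpha; field; now split).
  rewrite E; ring.
Qed.

(** * Convergent complex series and double series *)

(** Convergence with an explicit epsilon keeps the estimates below elementary;
    [sums_to_CSeries] links it to [CSeries]. *)
Definition sums_to (u : nat -> C) (s : C) : Prop :=
  forall eps : R, (0 < eps)%R ->
  exists N, forall n, (N <= n)%nat -> (Cmod (sum_n u n - s) < eps)%R.

Lemma sums_to_ext u v s : (forall n, u n = v n) -> sums_to u s -> sums_to v s.
Proof.
  intros H Hu eps He; destruct (Hu eps He) as [N HN]; exists N; intros n Hn.
  rewrite <- (sum_n_ext u v); auto.
Qed.

Lemma im_le_Cmod (c : C) : (Rabs (Im c) <= Cmod c)%R.
Proof.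
  eapply Rle_trans; [|apply Rmax_Cmod]; apply Rmax_r.
Qed.

Lemma Cmod_le_parts (c : C) : (Cmod c <= Rabs (Re c) + Rabs (Im c))%R.
Proof.
  replace c with (RtoC (Re c) + Ci * RtoC (Im c)) at 1
    by (destruct c as [x y]; unfold Ci, Cplus, Cmult, RtoC; simpl; f_equal; ring).
  eapply Rle_trans; [apply Cmod_triangle|].
  rewrite Cmod_mult, Cmod_Ci, !Cmod_R, Rmult_1_l; apply Rle_refl.
Qed.

Lemma is_series_eps (f : nat -> R) (x : R) :
  is_series f x <->
  forall eps : R, (0 < eps)%R ->
    exists N, forall n, (N <= n)%nat -> (Rabs (sum_n f n - x) < eps)%R.
Proof.
  split.
  - intros H eps He.
    assert (H' : is_lim_seq (sum_n f) x) by exact H.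
    apply is_lim_seq_spec in H'; exact (H' (mkposreal eps He)).
  - intros H.
    assert (H' : is_lim_seq (sum_n f) x); [|exact H'].
    apply is_lim_seq_spec; intros eps; apply H, cond_pos.
Qed.

Lemma sums_to_parts (u : nat -> C) (s : C) :
  sums_to u s <->
  is_series (fun n => Re (u n)) (Re s) /\ is_series (fun n => Im (u n)) (Im s).
Proof.
  assert (HR : forall n, (sum_n (fun m => Re (u m)) n - Re s = Re (sum_n u n - s))%R)
    by (intros n; rewrite sum_n_ReIm; destruct s; reflexivity).
  assert (HI : forall n, (sum_n (fun m => Im (u m)) n - Im s = Im (sum_n u n - s))%R)
    by (intros n; rewrite sum_n_ReIm; destruct s; reflexivity).
  rewrite !is_series_eps; split.
  - intros H; split; intros eps He; destruct (H eps He) as [N HN];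
      exists N; intros n Hn; specialize (HN n Hn).
    + rewrite HR; eapply Rle_lt_trans; [apply re_le_Cmod|exact HN].
    + rewrite HI; eapply Rle_lt_trans; [apply im_le_Cmod|exact HN].
  - intros [H1 H2] eps He.
    destruct (H1 (eps / 2)%R ltac:(lra)) as [N1 HN1].
    destruct (H2 (eps / 2)%R ltac:(lra)) as [N2 HN2].
    exists (Nat.max N1 N2); intros n Hn.
    specialize (HN1 n ltac:(lia)); specialize (HN2 n ltac:(lia)).
    rewrite HR in HN1; rewrite HI in HN2.
    eapply Rle_lt_trans; [apply Cmod_le_parts|lra].
Qed.

Lemma sums_to_CSeries u s : sums_to u s -> CSeries u = s.
Proof.
  rewrite sums_to_parts; intros [H1 H2]; unfold CSeries.
  rewrite (is_series_unique _ _ H1), (is_series_unique _ _ H2); now destruct s.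
Qed.

Lemma sums_to_unique u s t : sums_to u s -> sums_to u t -> s = t.
Proof.
  intros H1 H2; rewrite <- (sums_to_CSeries u s H1); now apply sums_to_CSeries.
Qed.

Lemma sums_to_of_bound u M r :
  (0 <= r < 1)%R -> (forall n, (Cmod (u n) <= M * r ^ n)%R) ->
  sums_to u (CSeries u).
Proof.
  intros Hr Hu.
  assert (Hg : ex_series (fun n => (M * r ^ n)%R)).
  { apply (ex_series_scal_l M (fun n => (r ^ n)%R)), ex_series_geom.
    rewrite Rabs_pos_eq; lra. }
  assert (H : forall p : C -> R, (forall c, (Rabs (p c) <= Cmod c)%R) ->
    ex_series (fun n => p (u n))).
  { intros p Hp.
    apply (@ex_series_le R_AbsRing R_CompleteNormedModule _ (fun n => (M * r ^ n)%R)); [|exact Hg].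
    intros n; eapply Rle_trans; [apply Hp|apply Hu]. }
  apply sums_to_parts; split; apply Series_correct.
  - apply H, re_le_Cmod.
  - apply H, im_le_Cmod.
Qed.

Lemma sums_to_plus u v s t : sums_to u s -> sums_to v t -> sums_to (fun n => u n + v n) (s + t).
Proof.
  intros Hu Hv eps He.
  destruct (Hu (eps / 2)%R ltac:(lra)) as [N1 HN1].
  destruct (Hv (eps / 2)%R ltac:(lra)) as [N2 HN2].
  exists (Nat.max N1 N2); intros n Hn.
  specialize (HN1 n ltac:(lia)); specialize (HN2 n ltac:(lia)).
  rewrite csum_plus.
  replace (sum_n u n + sum_n v n - (s + t)) with ((sum_n u n - s) + (sum_n v n - t)) by ring.
  eapply Rle_lt_trans; [apply Cmod_triangle|lra].
Qed.

Lemma sums_to_scal c u s : sums_to u s -> sums_to (fun n => c * u n) (c * s).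
Proof.
  intros Hu eps He.
  assert (Hc := Cmod_ge_0 c).
  destruct (Hu (eps / (Cmod c + 1))%R) as [N HN]; [apply Rdiv_lt_0_compat; lra|].
  exists N; intros n Hn; specialize (HN n Hn).
  rewrite csum_mult_l.
  replace (c * sum_n u n - c * s) with (c * (sum_n u n - s)) by ring.
  rewrite Cmod_mult.
  apply Rle_lt_trans with ((Cmod c + 1) * Cmod (sum_n u n - s))%R.
  - apply Rmult_le_compat_r; [apply Cmod_ge_0|lra].
  - apply Rmult_lt_reg_l with (/ (Cmod c + 1))%R; [apply Rinv_0_lt_compat; lra|].
    field_simplify; lra.
Qed.

(** The partial sums between n and n + d differ by at most a geometric sum; the
    bound passes to the limit. *)
Lemma sums_to_tail u s M r n :
  (0 < r < 1)%R -> (forall n, (Cmod (u n) <= M * r ^ n)%R) -> sums_to u s ->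
  (Cmod (sum_n u n - s)%C <= M * r ^ (S n) / (1 - r))%R.
Proof.
  intros Hr Hu Hs.
  assert (HM : (0 <= M)%R)
    by (specialize (Hu O); simpl in Hu; assert (H := Cmod_ge_0 (u O)); lra).
  assert (Hd : forall d, (Cmod (sum_n u (n + d) - sum_n u n)%C
    <= M * (r ^ (S n) - r ^ (S (n + d))) / (1 - r))%R).
  { induction d as [|d IH].
    - rewrite Nat.add_0_r; replace (sum_n u n - sum_n u n) with (RtoC 0) by ring.
      rewrite Cmod_0; apply Req_le; field; lra.
    - rewrite Nat.add_succ_r, csum_Sn.
      replace (sum_n u (n + d) + u (S (n + d)) - sum_n u n)
        with ((sum_n u (n + d) - sum_n u n) + u (S (n + d))) by ring.
      eapply Rle_trans; [apply Cmod_triangle|].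
      specialize (Hu (S (n + d))).
      eapply Rle_trans; [apply Rplus_le_compat; [exact IH|exact Hu]|].
      apply Req_le; simpl; field; lra. }
  apply le_epsilon; intros eps He.
  destruct (Hs eps He) as [N HN]; specialize (HN (n + N)%nat ltac:(lia)).
  replace (sum_n u n - s) with (- (sum_n u (n + N) - sum_n u n) + (sum_n u (n + N) - s)) by ring.
  eapply Rle_trans; [apply Cmod_triangle|]; rewrite Cmod_opp.
  apply Rplus_le_compat; [|lra].
  eapply Rle_trans; [apply Hd|].
  apply Rmult_le_compat_r; [left; apply Rinv_0_lt_compat; lra|].
  apply Rmult_le_compat_l; [assumption|].
  assert (H := pow_lt r (S (n + N)) ltac:(lra)); lra.
Qed.

Lemma Cmod_sum_le (f : nat -> C) n B :
  (forall i, (i <= n)%nat -> (Cmod (f i) <= B)%R) ->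
  (Cmod (sum_n f n) <= INR (S n) * B)%R.
Proof.
  induction n as [|n IH]; intros H.
  - rewrite sum_O; simpl INR; rewrite Rmult_1_l; now apply H.
  - rewrite csum_Sn, S_INR, Rmult_plus_distr_r, Rmult_1_l.
    eapply Rle_trans; [apply Cmod_triangle|apply Rplus_le_compat].
    + apply IH; intros i Hi; apply H; lia.
    + now apply H.
Qed.

Lemma INR_mul_pow_le q n : (0 < q < 1)%R -> (INR n * q ^ n <= / (1 - q))%R.
Proof.
  intros Hq.
  assert (H : (INR n * q ^ n * (1 - q) <= 1 - q ^ n)%R).
  { induction n as [|n IH]; [simpl; lra|].
    rewrite S_INR; simpl pow.
    assert (Hp := pow_lt q n ltac:(lra)).
    assert (Hp1 : (q ^ n <= 1)%R) by (rewrite <- (pow1 n); apply pow_incr; lra).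
    assert (H1 : (q * (INR n * q ^ n * (1 - q)) <= q * (1 - q ^ n))%R)
      by (apply Rmult_le_compat_l; lra).
    assert (H2 : (q * q ^ n * (1 - q) <= 1 * (1 - q))%R).
    { apply Rmult_le_compat_r; [lra|].
      apply Rle_trans with (1 * 1)%R; [apply Rmult_le_compat; lra|lra]. }
    lra. }
  apply Rmult_le_reg_r with (1 - q)%R; [lra|].
  rewrite Rinv_l by lra.
  assert (Hp := pow_lt q n ltac:(lra)); lra.
Qed.

Lemma sqrt_in_unit r : (0 < r < 1)%R -> (0 < sqrt r < 1)%R.
Proof.
  intros Hr; split; [apply sqrt_lt_R0; lra|].
  rewrite <- sqrt_1; apply sqrt_lt_1; lra.
Qed.

(** A linear factor is absorbed by replacing the ratio r by its square root. *)
Lemma INR_mul_pow_sqrt r n :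
  (0 < r < 1)%R -> (INR n * r ^ n <= / (1 - sqrt r) * sqrt r ^ n)%R.
Proof.
  intros Hr.
  assert (Hq := sqrt_in_unit r Hr).
  rewrite <- (sqrt_sqrt r) at 1 by lra.
  rewrite Rpow_mult_distr, <- Rmult_assoc.
  apply Rmult_le_compat_r; [apply pow_le; lra|now apply INR_mul_pow_le].
Qed.

Lemma sum_triangle (u : nat -> nat -> C) N :
  sum_n (fun n => sum_n (fun i => u i (n - i)%nat) n) N
  = sum_n (fun i => sum_n (u i) (N - i)) N.
Proof.
  induction N as [|N IH]; [now rewrite !sum_O|].
  rewrite csum_Sn, IH, csum_Sn, csum_Sn, Nat.sub_diag, sum_O.
  rewrite (sum_n_ext_loc (fun i => sum_n (u i) (S N - i))
    (fun i => sum_n (u i) (N - i) + u i (S N - i)%nat)).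
  - rewrite csum_plus; cring.
  - intros i Hi; replace (S N - i)%nat with (S (N - i)) by lia; apply csum_Sn.
Qed.

(** Summing a geometrically bounded double series by rows or by antidiagonals
    gives the same value.  The antidiagonal partial sum of order N consists of
    the first N + 1 rows, the row i being cut after N - i; each of the N + 1
    tails is O(r^(N + 1)), and (N + 1) r^(N + 1) tends to 0. *)
Lemma sums_to_diagonal (u : nat -> nat -> C) (row : nat -> C) (s : C) (M r : R) :
  (0 < r < 1)%R -> (forall i j, (Cmod (u i j) <= M * r ^ (i + j))%R) ->
  (forall i, sums_to (u i) (row i)) -> sums_to row s ->
  sums_to (fun n => sum_n (fun i => u i (n - i)%nat) n) s.
Proof.
  intros Hr Hu Hrow Hs eps He.
  assert (HM : (0 <= M)%R)
    by (specialize (Hu O O); simpl in Hu; assert (H := Cmod_ge_0 (u O O)); lra).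
  assert (Hq := sqrt_in_unit r Hr).
  set (K := (M / (1 - r) * / (1 - sqrt r))%R).
  assert (HK : (0 <= K)%R).
  { unfold K; repeat apply Rmult_le_pos; try assumption; left; apply Rinv_0_lt_compat; lra. }
  assert (Hdiff : forall N, (Cmod (sum_n (fun i => sum_n (u i) (N - i) - row i)%C N)
    <= K * sqrt r ^ S N)%R).
  { intros N.
    apply Rle_trans with (INR (S N) * (M * r ^ S N / (1 - r)))%R.
    - apply Cmod_sum_le; intros i Hi.
      eapply Rle_trans; [apply (sums_to_tail (u i) (row i) (M * r ^ i) r)|]; auto.
      + intros j; rewrite Rmult_assoc, <- pow_add; apply Hu.
      + apply Req_le; replace (S N) with (i + S (N - i))%nat by lia.
        rewrite pow_add; unfold Rdiv; ring.
    - replace (INR (S N) * (M * r ^ S N / (1 - r)))%R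
        with (M / (1 - r) * (INR (S N) * r ^ S N))%R by (unfold Rdiv; ring).
      unfold K; rewrite Rmult_assoc; apply Rmult_le_compat_l.
      + apply Rmult_le_pos; [assumption|left; apply Rinv_0_lt_compat; lra].
      + now apply INR_mul_pow_sqrt. }
  destruct (Hs (eps / 2)%R ltac:(lra)) as [N1 HN1].
  destruct (pow_lt_1_zero (sqrt r) ltac:(rewrite Rabs_pos_eq; lra) (eps / 2 / (K + 1))%R)
    as [N2 HN2]; [repeat apply Rdiv_lt_0_compat; lra|].
  exists (Nat.max N1 N2); intros n Hn.
  specialize (HN1 n ltac:(lia)); specialize (HN2 (S n) ltac:(lia)).
  rewrite sum_triangle.
  replace (sum_n (fun i => sum_n (u i) (n - i)) n - s)
    with (sum_n (fun i => sum_n (u i) (n - i) - row i) n + (sum_n row n - s)).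
  - eapply Rle_lt_trans; [apply Cmod_triangle|].
    rewrite Rabs_pos_eq in HN2 by (apply pow_le; lra).
    assert (H : (K * sqrt r ^ S n <= (K + 1) * sqrt r ^ S n)%R)
      by (apply Rmult_le_compat_r; [apply pow_le|]; lra).
    assert (H' : ((K + 1) * sqrt r ^ S n < eps / 2)%R).
    { apply Rmult_lt_reg_l with (/ (K + 1))%R; [apply Rinv_0_lt_compat; lra|].
      rewrite <- Rmult_assoc, Rinv_l, Rmult_1_l by lra.
      eapply Rlt_le_trans; [exact HN2|apply Req_le; unfold Rdiv; ring]. }
    specialize (Hdiff n); lra.
  - assert (E : sum_n (fun i => sum_n (u i) (n - i) - row i + row i) n
      = sum_n (fun i => sum_n (u i) (n - i)) n :> C)
      by (apply sum_n_ext; intros i; cring).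
    rewrite <- E, (csum_plus (fun i => sum_n (u i) (n - i) - row i) row); cring.
Qed.

(** * Evaluation of power series *)

(** The geometric bound is part of the notion since it is what makes evaluation
    compatible with products. *)
Definition evaluates_to (x : C) (u : fps) (s : C) : Prop :=
  (exists M r, (0 < r < 1)%R /\ forall n, (Cmod (u n * x ^ n)%C <= M * r ^ n)%R)
  /\ sums_to (fun n => u n * x ^ n) s.

Lemma eval_unique x u s t : evaluates_to x u s -> evaluates_to x u t -> s = t.
Proof. intros [_ Hs] [_ Ht]; exact (sums_to_unique _ _ _ Hs Ht). Qed.

Lemma bounds_common (u v : nat -> C) M1 r1 M2 r2 :
  (0 < r1 < 1)%R -> (0 < r2 < 1)%R ->
  (forall n, (Cmod (u n) <= M1 * r1 ^ n)%R) ->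
  (forall n, (Cmod (v n) <= M2 * r2 ^ n)%R) ->
  exists M r, (0 < r < 1)%R /\ (0 <= M)%R /\
    forall n, (Cmod (u n) <= M * r ^ n)%R /\ (Cmod (v n) <= M * r ^ n)%R.
Proof.
  intros Hr1 Hr2 Hu Hv.
  assert (H1 : (0 <= M1)%R)
    by (specialize (Hu O); simpl in Hu; assert (H := Cmod_ge_0 (u O)); lra).
  assert (H2 : (0 <= M2)%R)
    by (specialize (Hv O); simpl in Hv; assert (H := Cmod_ge_0 (v O)); lra).
  exists (M1 + M2)%R, (Rmax r1 r2).
  assert (Hm1 := Rmax_l r1 r2); assert (Hm2 := Rmax_r r1 r2).
  repeat split.
  - lra.
  - apply Rmax_lub_lt; lra.
  - lra.
  - eapply Rle_trans; [apply Hu|apply Rmult_le_compat]; try lra.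
    + apply pow_le; lra.
    + apply pow_incr; lra.
  - eapply Rle_trans; [apply Hv|apply Rmult_le_compat]; try lra.
    + apply pow_le; lra.
    + apply pow_incr; lra.
Qed.

Lemma eval_add x u v s t :
  evaluates_to x u s -> evaluates_to x v t -> evaluates_to x (u + v)%fps (s + t).
Proof.
  intros [(M1 & r1 & Hr1 & Hu) Hs] [(M2 & r2 & Hr2 & Hv) Ht]; split.
  - destruct (bounds_common _ _ _ _ _ _ Hr1 Hr2 Hu Hv) as (M & r & Hr & HM & H).
    exists (2 * M)%R, r; split; [assumption|]; intros n; destruct (H n) as [Ha Hb].
    unfold fadd; rewrite Cmult_plus_distr_r.
    eapply Rle_trans; [apply Cmod_triangle|lra].
  - eapply sums_to_ext; [|apply (sums_to_plus _ _ _ _ Hs Ht)].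
    intros n; unfold fadd; simpl; ring.
Qed.

(** Apart from the bound, this is the rearrangement of the double series of the
    products of the terms. *)
Lemma eval_mul x u v s t :
  evaluates_to x u s -> evaluates_to x v t -> evaluates_to x (u * v)%fps (s * t).
Proof.
  intros [(M1 & r1 & Hr1 & Hu) Hs] [(M2 & r2 & Hr2 & Hv) Ht].
  destruct (bounds_common _ _ _ _ _ _ Hr1 Hr2 Hu Hv) as (M & r & Hr & HM & H).
  set (a := fun i j => (u i * x ^ i) * (v j * x ^ j)).
  assert (Ha : forall i j, (Cmod (a i j) <= M * M * r ^ (i + j))%R).
  { intros i j; unfold a; rewrite Cmod_mult, pow_add.
    replace (M * M * (r ^ i * r ^ j))%R with (M * r ^ i * (M * r ^ j))%R by ring.
    apply Rmult_le_compat; try apply Cmod_ge_0; apply H. }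
  assert (E : forall n, sum_n (fun i => a i (n - i)%nat) n = (u * v)%fps n * x ^ n).
  { intros n; unfold fmul; rewrite Cmult_comm, <- csum_mult_l.
    apply sum_n_ext_loc; intros i Hi; unfold a.
    replace n with (i + (n - i))%nat at 3 by lia; rewrite Cpow_add_r; cring. }
  split.
  - exists (M * M * (/ (1 - sqrt r) * sqrt r / r))%R, (sqrt r).
    assert (Hq := sqrt_in_unit r Hr).
    split; [assumption|]; intros n; rewrite <- E.
    eapply Rle_trans; [apply (Cmod_sum_le _ _ (M * M * r ^ n)%R)|].
    + intros i Hi; eapply Rle_trans; [apply Ha|].
      replace (i + (n - i))%nat with n by lia; apply Rle_refl.
    + replace (INR (S n) * (M * M * r ^ n))%R
        with (M * M * (INR (S n) * r ^ S n / r))%R by (simpl; field; lra).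
      rewrite (Rmult_assoc (M * M)); apply Rmult_le_compat_l; [apply Rmult_le_pos; assumption|].
      replace (/ (1 - sqrt r) * sqrt r / r * sqrt r ^ n)%R
        with (/ (1 - sqrt r) * sqrt r ^ S n / r)%R by (simpl; field; lra).
      apply Rmult_le_compat_r; [left; apply Rinv_0_lt_compat; lra|].
      now apply INR_mul_pow_sqrt.
  - eapply sums_to_ext; [apply E|].
    apply (sums_to_diagonal a (fun i => t * (u i * x ^ i)) _ (M * M) r Hr Ha).
    + intros i; rewrite Cmult_comm; apply (sums_to_scal (u i * x ^ i)), Ht.
    + rewrite Cmult_comm; now apply sums_to_scal.
Qed.

Lemma eval_finite (x : C) (u : fps) (s : C) N :
  (forall n, (N < n)%nat -> u n = 0) -> sum_n (fun n => u n * x ^ n) N = s -> evaluates_to x u s.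
Proof.
  intros Hu Hs; split.
  - assert (HB : exists B, (0 <= B)%R /\ forall n, (n <= N)%nat -> (Cmod (u n * x ^ n)%C <= B)%R).
    { clear Hu Hs; induction N as [|N [B [HB0 HB]]].
      - exists (Cmod (u O * x ^ O)%C); split; [apply Cmod_ge_0|].
        intros n Hn; replace n with O by lia; apply Rle_refl.
      - exists (Rmax B (Cmod (u (S N) * x ^ S N)%C)); split.
        + eapply Rle_trans; [exact HB0|apply Rmax_l].
        + intros n Hn; destruct (Nat.eq_dec n (S N)) as [->|Hne]; [apply Rmax_r|].
          eapply Rle_trans; [apply HB; lia|apply Rmax_l]. }
    destruct HB as [B [HB0 HB]].
    exists (B * 2 ^ N)%R, (1 / 2)%R; split; [lra|]; intros n.
    destruct (Nat.le_gt_cases n N) as [Hn|Hn].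
    + eapply Rle_trans; [apply HB, Hn|].
      rewrite Rmult_assoc; rewrite <- (Rmult_1_r B) at 1; apply Rmult_le_compat_l; [assumption|].
      replace N with (n + (N - n))%nat by lia; rewrite pow_add.
      replace (2 ^ n * 2 ^ (N - n) * (1 / 2) ^ n)%R with ((2 * (1 / 2)) ^ n * 2 ^ (N - n))%R
        by (rewrite Rpow_mult_distr; ring).
      replace (2 * (1 / 2))%R with 1%R by field; rewrite pow1, Rmult_1_l.
      apply pow_R1_Rle; lra.
    + rewrite Hu, Cmult_0_l, Cmod_0 by assumption.
      apply Rmult_le_pos; [apply Rmult_le_pos; [assumption|]|]; apply pow_le; lra.
  - intros eps He; exists N; intros n Hn.
    replace (sum_n (fun n => u n * x ^ n) n) with s.
    + replace (s - s) with (RtoC 0) by ring; now rewrite Cmod_0.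
    + induction Hn as [|n Hn IH]; [now symmetry|].
      rewrite csum_Sn, <- IH, Hu by lia; cring.
Qed.

Lemma eval_cst x c : evaluates_to x (cst c) c.
Proof.
  apply (eval_finite _ _ _ O).
  - intros [|n] Hn; [lia|reflexivity].
  - rewrite sum_O; simpl; cring.
Qed.

Lemma eval_X x : evaluates_to x X x.
Proof.
  apply (eval_finite _ _ _ 1).
  - intros [|[|n]] Hn; [lia|lia|reflexivity].
  - rewrite csum_Sn, sum_O; simpl; cring.
Qed.

Lemma eval_Y x : evaluates_to x Y (1 - x).
Proof.
  replace Y with (fone + cst (- (1)) * X)%fps by (unfold Y; rewrite cst_opp; ring).
  replace (1 - x) with (1 + - (1) * x) by ring.
  apply eval_add; [apply eval_cst|apply eval_mul; [apply eval_cst|apply eval_X]].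
Qed.

Lemma eval_pow x u s n : evaluates_to x u s -> evaluates_to x (fpow u n) (s ^ n).
Proof.
  intros H; induction n as [|n IH]; [apply eval_cst|].
  now apply eval_mul.
Qed.

Lemma eval_fsum x f s n :
  (forall i, (i <= n)%nat -> evaluates_to x (f i) (s i)) -> evaluates_to x (fsum f n) (sum_n s n).
Proof.
  induction n as [|n IH]; intros H.
  - rewrite sum_O; now apply H.
  - rewrite csum_Sn; apply eval_add; [apply IH; intros i Hi|]; apply H; lia.
Qed.

Lemma eval_F211 (a b c x : C) (k l : nat) :
  (forall i, c + INR i <> 0) ->
  evaluates_to x (F211_fps a b c k l) (F211_terminating a b c k l x (1 - x)).
Proof.
  intros Hc; apply eval_fsum; intros p Hp; apply eval_fsum; intros q Hq.
  replace (F211_term a b (- INR k) (- INR l) c (- (2 * INR k)) (- (2 * INR l)) x (1 - x) p q)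
    with (central a b c (p + q) * bessel_coef k p * bessel_coef l q * (x ^ p * (1 - x) ^ q)).
  - apply eval_mul; [apply eval_cst|].
    apply eval_mul; apply eval_pow; [apply eval_X|apply eval_Y].
  - assert (H1 : poch (- (2 * INR k)) p <> 0)
      by (rewrite INR_double; apply poch_neg_neq_0; lia).
    assert (H2 : poch (- (2 * INR l)) q <> 0)
      by (rewrite INR_double; apply poch_neg_neq_0; lia).
    assert (H3 : poch c (p + q) <> 0) by (apply poch_neq_0; auto).
    unfold F211_term, central, bessel_coef; field; auto using fact_neq_0_C.
Qed.

(** Consecutive coefficients have the ratio (A + n) (B + n) / ((D + n) (n + 1)),
    which is bounded because D + n stays away from 0. *)
Lemma hcoef_bound (A B D : C) :
  (forall n, (1 / 2 <= Cmod (D + INR n)%C)%R) ->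
  exists rho, (1 <= rho)%R /\ forall n, (Cmod (hcoef A B D n) <= rho ^ n)%R.
Proof.
  intros HD.
  assert (HD0 : forall i, D + INR i <> 0)
    by (intros i H; specialize (HD i); rewrite H, Cmod_0 in HD; lra).
  (* KD bounds (n + 1) / |D + n|, since n + 1 = (D + n) + (1 - D). *)
  set (KA := (Cmod A + 1)%R); set (KB := (Cmod B + 1)%R); set (KD := (1 + 2 * Cmod (1 - D)%C)%R).
  assert (HA := Cmod_ge_0 A); assert (HB := Cmod_ge_0 B); assert (HDD := Cmod_ge_0 (1 - D)%C).
  assert (Hlin : forall x n, (Cmod (x + INR n)%C <= (Cmod x + 1) * (INR n + 1))%R).
  { intros x n; eapply Rle_trans; [apply Cmod_triangle|].
    assert (Hn := pos_INR n); assert (Hx := Cmod_ge_0 x).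
    rewrite Cmod_R, Rabs_pos_eq by assumption.
    assert (H := Rmult_le_pos _ _ Hx Hn); lra. }
  assert (Hden : forall n, (INR n + 1 <= KD * Cmod (D + INR n)%C)%R).
  { intros n; specialize (HD n); unfold KD.
    apply Rle_trans with (Cmod (D + INR n)%C + Cmod (1 - D)%C)%R.
    - eapply Rle_trans; [|apply Cmod_triangle].
      replace (D + INR n + (1 - D)) with (RtoC (INR n + 1)) by (rewrite RtoC_plus; ring).
      rewrite Cmod_R; apply Rle_abs.
    - assert (H : (Cmod (1 - D)%C * 1 <= Cmod (1 - D)%C * (2 * Cmod (D + INR n)%C))%R)
        by (apply Rmult_le_compat_l; lra).
      lra. }
  exists (KA * KB * KD)%R; split.
  - apply Rle_trans with (1 * 1 * 1)%R; [lra|].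
    repeat apply Rmult_le_compat; unfold KA, KB, KD; lra.
  - induction n as [|n IH].
    + rewrite hcoef_0, Cmod_1; simpl; lra.
    + assert (E := hcoef_S A B D n HD0).
      apply (f_equal Cmod) in E; rewrite !Cmod_mult in E.
      assert (Hn := pos_INR n).
      replace (Cmod (INR n + 1)%C) with (INR n + 1)%R in E.
      2:{ rewrite <- INR_S, Cmod_R, S_INR, Rabs_pos_eq; lra. }
      assert (HDn := HD n).
      apply Rmult_le_reg_l with ((INR n + 1) * Cmod (D + INR n)%C)%R;
        [apply Rmult_lt_0_compat; lra|].
      rewrite E.
      apply Rle_trans with (KA * (INR n + 1) * (KB * (INR n + 1)) * (KA * KB * KD) ^ n)%R.
      * repeat apply Rmult_le_compat; try apply Cmod_ge_0; try apply Hlin; try assumption.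
        apply Rmult_le_pos; apply Cmod_ge_0.
      * simpl pow.
        assert (HP : (0 <= KA * (INR n + 1) * KB * (KA * KB * KD) ^ n)%R).
        { repeat apply Rmult_le_pos; try apply pow_le; try (repeat apply Rmult_le_pos);
            unfold KA, KB, KD; lra. }
        assert (H := Rmult_le_compat_l _ _ _ HP (Hden n)).
        eapply Rle_trans; [|eapply Rle_trans; [exact H|]]; apply Req_le; ring.
Qed.

Lemma eval_hyp2F1 (A B D : C) rho x :
  (forall n, (Cmod (hcoef A B D n) <= rho ^ n)%R) -> (1 <= rho)%R ->
  (rho * Cmod x <= 1 / 2)%R -> evaluates_to x (hcoef A B D) (hyp2F1 A B D x).
Proof.
  intros Hh Hrho Hx.
  assert (H : forall n, (Cmod (hcoef A B D n * x ^ n)%C <= 1 * (1 / 2) ^ n)%R).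
  { intros n; rewrite Cmod_mult, Cmod_pow, Rmult_1_l.
    apply Rle_trans with ((rho * Cmod x) ^ n)%R.
    - rewrite Rpow_mult_distr; apply Rmult_le_compat_r; [apply pow_le, Cmod_ge_0|apply Hh].
    - apply pow_incr; split; [|assumption].
      apply Rmult_le_pos; [lra|apply Cmod_ge_0]. }
  split; [exists 1%R, (1 / 2)%R; split; [lra|exact H]|].
  apply (sums_to_of_bound _ 1 (1 / 2)); [lra|exact H].
Qed.

(** * The binomial series *)

Definition has_deriv (f : R -> C) (t : R) (d : C) : Prop :=
  is_derive (fun x => Re (f x)) t (Re d) /\ is_derive (fun x => Im (f x)) t (Im d).

Lemma deriv_ext f g t d : (forall x, f x = g x) -> has_deriv f t d -> has_deriv g t d.
Proof.
  intros H [H1 H2]; split;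
    [apply (is_derive_ext (fun x => Re (f x)))|apply (is_derive_ext (fun x => Im (f x)))];
    auto; intros x; now rewrite H.
Qed.

Ltac derive_from_hyps :=
  auto_derive; [repeat split; eexists; eassumption|];
  repeat match goal with
  | H : is_derive ?f ?t _ |- context [Derive ?g ?t] =>
      change (Derive g t) with (Derive f t); rewrite (is_derive_unique f t _ H)
  end.

Lemma deriv_mult f g t df dg :
  has_deriv f t df -> has_deriv g t dg -> has_deriv (fun x => f x * g x) t (df * g t + f t * dg).
Proof.
  assert (D : forall (f1 f2 g1 g2 : R -> R) d1 d2 e1 e2 c,
    is_derive f1 t d1 -> is_derive f2 t d2 -> is_derive g1 t e1 -> is_derive g2 t e2 ->
    is_derive (fun x => (f1 x * g1 x + c * (f2 x * g2 x))%R) t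
      (d1 * g1 t + f1 t * e1 + c * (d2 * g2 t + f2 t * e2))%R).
  { intros f1 f2 g1 g2 d1 d2 e1 e2 c F1 F2 G1 G2; derive_from_hyps; ring. }
  intros [F1 F2] [G1 G2]; split.
  - apply (is_derive_ext (fun x => (Re (f x) * Re (g x) + -1 * (Im (f x) * Im (g x)))%R)).
    { intros x; unfold Cmult; simpl; unfold Re, Im; ring. }
    replace (Re (df * g t + f t * dg)) with
      (Re df * Re (g t) + Re (f t) * Re dg + -1 * (Im df * Im (g t) + Im (f t) * Im dg))%R
      by (unfold Cplus, Cmult, Re, Im; simpl; ring).
    now apply D.
  - apply (is_derive_ext (fun x => (Re (f x) * Im (g x) + 1 * (Im (f x) * Re (g x)))%R)).
    { intros x; unfold Cmult; simpl; unfold Re, Im; ring. }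
    replace (Im (df * g t + f t * dg)) with
      (Re df * Im (g t) + Re (f t) * Im dg + 1 * (Im df * Re (g t) + Im (f t) * Re dg))%R
      by (unfold Cplus, Cmult, Re, Im; simpl; ring).
    now apply D.
Qed.

Lemma deriv_Cexp f t df : has_deriv f t df -> has_deriv (fun x => Cexp (f x)) t (df * Cexp (f t)).
Proof.
  assert (D : forall (f1 f2 : R -> R) d1 d2,
    is_derive f1 t d1 -> is_derive f2 t d2 ->
    is_derive (fun x => (exp (f1 x) * cos (f2 x))%R) t
      (d1 * (exp (f1 t) * cos (f2 t)) - d2 * (exp (f1 t) * sin (f2 t)))%R
    /\ is_derive (fun x => (exp (f1 x) * sin (f2 x))%R) t
      (d1 * (exp (f1 t) * sin (f2 t)) + d2 * (exp (f1 t) * cos (f2 t)))%R).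
  { intros f1 f2 d1 d2 F1 F2; split; derive_from_hyps; ring. }
  intros [F1 F2]; exact (D _ _ _ _ F1 F2).
Qed.

Lemma deriv_scal c f t df : has_deriv f t df -> has_deriv (fun x => c * f x) t (c * df).
Proof.
  intros H; assert (H0 : has_deriv (fun _ => c) t 0)
    by (split; simpl; apply (@is_derive_const R_AbsRing R_NormedModule)).
  assert (H1 := deriv_mult _ _ _ _ _ H0 H).
  now replace (c * df) with (0 * f t + c * df) by ring.
Qed.

(** Along the segment from 1 to 1 - z, in the half-plane where [Clog] is the
    principal logarithm. *)
Lemma deriv_Clog (z : C) (t : R) :
  (0 < 1 - t * Re z)%R ->
  has_deriv (fun x => Clog (1 - RtoC x * z)) t (- z / (1 - RtoC t * z)).
Proof.
  assert (D1 : forall (q : R -> R) dq, is_derive q t dq -> (0 < q t)%R ->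
    is_derive (fun s => ln (sqrt (q s))) t (dq / (2 * q t))%R).
  { intros q dq Hq Hpos; assert (Hs := sqrt_lt_R0 _ Hpos).
    auto_derive; [repeat split; try assumption; eexists; eassumption|].
    change (Derive (fun s => q s) t) with (Derive q t); rewrite (is_derive_unique q t _ Hq).
    rewrite <- (sqrt_sqrt (q t)) at 3 by lra; field; lra. }
  assert (D2 : forall (n d : R -> R) dn dd, is_derive n t dn -> is_derive d t dd -> (d t <> 0)%R ->
    is_derive (fun s => atan (n s / d s)) t
      ((dn * d t - n t * dd) / (d t ^ 2 + n t ^ 2))%R).
  { intros n d dn dd Hn Hd Hd0.
    assert (Hp : (0 < d t ^ 2 + n t ^ 2)%R).
    { assert (H1 := pow2_gt_0 _ Hd0); assert (H2 := pow2_ge_0 (n t)); lra. }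
    auto_derive; [repeat split; try assumption; eexists; eassumption|].
    change (Derive (fun s => n s) t) with (Derive n t); rewrite (is_derive_unique n t _ Hn).
    change (Derive (fun s => d s) t) with (Derive d t); rewrite (is_derive_unique d t _ Hd).
    field; split; [lra|assumption]. }
  destruct z as [x y]; simpl; intros Hpos.
  assert (Hq : (0 < (1 - t * x) ^ 2 + (t * y) ^ 2)%R).
  { apply Rplus_lt_le_0_compat; [now apply pow_lt|apply pow2_ge_0]. }
  apply (deriv_ext (fun s => (ln (sqrt ((1 - s * x) ^ 2 + (s * y) ^ 2)), atan (- (s * y) / (1 - s * x))))).
  { intros s; unfold Clog, Cmod; simpl; f_equal.
    - do 3 f_equal; ring.
    - f_equal; f_equal; ring. }
  replace (- (x, y) / (1 - RtoC t * (x, y))) with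
    ((- x * (1 - t * x) + y * (t * y)) / ((1 - t * x) ^ 2 + (t * y) ^ 2),
     (- y * (1 - t * x) - x * (t * y)) / ((1 - t * x) ^ 2 + (t * y) ^ 2))%R.
  - split; unfold Re, Im; cbn [fst snd].
    + replace ((- x * (1 - t * x) + y * (t * y)) / ((1 - t * x) ^ 2 + (t * y) ^ 2))%R with
        ((- 2 * x * (1 - t * x) + 2 * y * (t * y)) / (2 * ((1 - t * x) ^ 2 + (t * y) ^ 2)))%R
        by (field; simpl in *; lra).
      apply (D1 (fun s => (1 - s * x) ^ 2 + (s * y) ^ 2)%R); [|exact Hq].
      auto_derive; [exact I|ring].
    + replace ((- y * (1 - t * x) - x * (t * y)) / ((1 - t * x) ^ 2 + (t * y) ^ 2))%R with
        ((- y * (1 - t * x) - (- (t * y)) * - x) / ((1 - t * x) ^ 2 + (- (t * y)) ^ 2))%R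
        by (field; simpl in *; lra).
      apply (D2 (fun s => - (s * y))%R (fun s => 1 - s * x)%R); [| |lra];
        auto_derive; try exact I; ring.
  - assert (Hne : 1 - RtoC t * (x, y) <> 0).
    { intros H; apply (f_equal Re) in H; unfold Re in H; simpl in H; lra. }
    apply (Cmult_reg (1 - RtoC t * (x, y))); [assumption|].
    replace ((1 - RtoC t * (x, y)) * (- (x, y) / (1 - RtoC t * (x, y)))) with (- (x, y))
      by (field; assumption).
    unfold Cmult, Cminus, Cplus, Copp, RtoC; simpl; f_equal; field; simpl in *; lra.
Qed.

Definition bcoef (s : C) (j : nat) : C := poch s j / INR (fact j).

Lemma bcoef_S s j : (INR j + 1) * bcoef s (S j) = (s + INR j) * bcoef s j.
Proof.
  unfold bcoef; rewrite fact_S_C; simpl poch.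
  field; split; [apply fact_neq_0_C|apply INR_S_neq_0].
Qed.

(** The rising factorial of a natural number, as a majorant of [poch]. *)
Fixpoint rising (m j : nat) : R :=
  match j with O => 1%R | S i => (rising m i * (INR m + INR i))%R end.

(** For natural m, (m)_j / j! is a binomial coefficient; Pascal's rule, in the
    form [Hpascal], gives the bound 2^(m + j). *)
Lemma bcoef_bound s d j :
  (Cmod s <= INR d)%R -> (Cmod (bcoef s j) <= 2 ^ (d + j))%R.
Proof.
  assert (Hleft : forall j m, (rising m (S j) = INR m * rising (S m) j)%R).
  { induction j0 as [|i IH]; intros m; [simpl; ring|].
    change (rising m (S i) * (INR m + INR (S i)) = INR m * (rising (S m) i * (INR (S m) + INR i)))%R.
    rewrite IH, !S_INR; ring. }
  assert (Hpascal : forall m j, (rising (S m) (S j) = rising m (S j) + INR (S j) * rising (S m) j)%R).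
  { intros m i; rewrite (Hleft i m).
    change (rising (S m) (S i)) with (rising (S m) i * (INR (S m) + INR i))%R.
    rewrite !S_INR; ring. }
  assert (Hg : forall n m j, (m + j <= n)%nat -> (0 <= rising m j <= 2 ^ (m + j) * INR (fact j))%R).
  { induction n as [|n IH]; intros m [|i] Hn.
    - simpl; assert (H := pow_R1_Rle 2 (m + 0) ltac:(lra)); lra.
    - lia.
    - simpl; assert (H := pow_R1_Rle 2 (m + 0) ltac:(lra)); lra.
    - destruct m as [|m].
      + rewrite Hleft; simpl (INR 0); rewrite Rmult_0_l; split; [lra|].
        apply Rmult_le_pos; [apply pow_le; lra|apply pos_INR].
      + rewrite Hpascal.
        destruct (IH m (S i) ltac:(lia)) as [L1 U1].
        destruct (IH (S m) i ltac:(lia)) as [L2 U2].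
        assert (Hi := pos_INR (S i)); split.
        * assert (H := Rmult_le_pos _ _ Hi L2); lra.
        * assert (H := Rmult_le_compat_l _ _ _ Hi U2).
          eapply Rle_trans; [apply Rplus_le_compat; [exact U1|exact H]|].
          apply Req_le; replace (S m + S i)%nat with (S (S m + i)) by lia.
          replace (m + S i)%nat with (S m + i)%nat by lia.
          change (fact (S i)) with (S i * fact i)%nat; rewrite mult_INR.
          simpl pow; ring. }
  intros Hs.
  assert (Hp : (Cmod (poch s j) <= rising d j)%R).
  { induction j as [|j IH]; [simpl; rewrite Cmod_1; lra|].
    change (poch s (S j)) with (poch s j * (s + INR j)); rewrite Cmod_mult.
    change (rising d (S j)) with (rising d j * (INR d + INR j))%R.
    apply Rmult_le_compat; try apply Cmod_ge_0; [assumption|].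
    eapply Rle_trans; [apply Cmod_triangle|].
    rewrite Cmod_R, Rabs_pos_eq by apply pos_INR; lra. }
  assert (Hf := INR_fact_lt_0 j).
  unfold bcoef; rewrite Cmod_div by apply fact_neq_0_C.
  rewrite Cmod_R, Rabs_pos_eq by lra.
  apply Rmult_le_reg_r with (INR (fact j)); [assumption|].
  unfold Rdiv; rewrite Rmult_assoc, Rinv_l, Rmult_1_r by lra.
  eapply Rle_trans; [exact Hp|]; apply (Hg (d + j)%nat); lia.
Qed.

Lemma exists_nat_ge (x : R) : exists d : nat, (x <= INR d)%R.
Proof.
  destruct (archimed_cor1 (/ (Rabs x + 1)) ) as [d [Hd Hd0]].
  { apply Rinv_0_lt_compat; assert (H := Rabs_pos x); lra. }
  exists d; left.
  assert (H := Rle_abs x); assert (H0 := Rabs_pos x).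
  apply Rinv_lt_cancel in Hd; [lra|apply lt_0_INR; lia].
Qed.

Lemma sums_to_shift u s :
  sums_to u s -> sums_to (fun n => match n with O => 0 | S m => u m end) s.
Proof.
  intros H eps He; destruct (H eps He) as [N HN]; exists (S N).
  intros [|n] Hn; [lia|].
  rewrite csum_head, Cplus_0_l.
  apply HN; lia.
Qed.

Lemma real_series_inside (a : nat -> R) t :
  Rbar_lt (Rabs t) (CV_radius a) -> is_series (fun k => (a k * t ^ k)%R) (PSeries a t).
Proof.
  intros H; apply Series_correct, ex_series_Rabs, CV_disk_inside, H.
Qed.

Lemma Cexp_add u v : Cexp (u + v) = Cexp u * Cexp v.
Proof.
  destruct u as [a b], v as [c d]; unfold Cexp, Cmult, Cplus; simpl.
  rewrite exp_plus, cos_plus, sin_plus; f_equal; ring.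
Qed.

Lemma Cexp_0 : Cexp 0 = 1.
Proof. unfold Cexp; simpl; rewrite exp_0, cos_0, sin_0; unfold RtoC; f_equal; ring. Qed.

(** The radius of convergence of both components is at least 3/2, which covers the
    closed segment. *)
Lemma power_series_deriv (a : nat -> C) (B : R) (t : R) :
  (forall n, (Cmod (a n) <= B * (1 / 2) ^ n)%R) -> (Rabs t <= 1)%R ->
  exists d, has_deriv (fun t => CSeries (fun j => a j * RtoC t ^ j)) t d
    /\ sums_to (fun j => (INR j + 1) * a (S j) * RtoC t ^ j) d.
Proof.
  intros Ha Ht.
  assert (HB : (0 <= B)%R)
    by (specialize (Ha O); simpl in Ha; assert (H := Cmod_ge_0 (a O)); lra).
  assert (Hrad : forall p : C -> R, (forall c, (Rabs (p c) <= Cmod c)%R) ->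
    Rbar_lt (Rabs t) (CV_radius (fun n => p (a n)))).
  { intros p Hp; apply Rbar_lt_le_trans with (Finite (3 / 2)); [simpl; lra|].
    apply (proj1 (CV_radius_bounded (fun n => p (a n)))); exists B; intros n.
    rewrite Rabs_mult, (Rabs_pos_eq ((3 / 2) ^ n)) by (apply pow_le; lra).
    apply Rle_trans with (B * (1 / 2) ^ n * (3 / 2) ^ n)%R.
    - apply Rmult_le_compat_r; [apply pow_le; lra|].
      eapply Rle_trans; [apply Hp|apply Ha].
    - rewrite Rmult_assoc, <- Rpow_mult_distr.
      apply Rle_trans with (B * 1)%R; [|lra].
      apply Rmult_le_compat_l; [assumption|].
      apply Rle_trans with (1 ^ n)%R; [apply pow_incr; lra|rewrite pow1; lra]. }
  assert (HR := Hrad Re re_le_Cmod); assert (HI := Hrad Im im_le_Cmod).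
  assert (Hpow : forall (c : C) (x : R) n,
    Re (c * RtoC x ^ n) = (Re c * x ^ n)%R /\ Im (c * RtoC x ^ n) = (Im c * x ^ n)%R).
  { intros c x n; rewrite <- RtoC_pow; destruct c; unfold Re, Im; simpl; split; ring. }
  exists (PSeries (PS_derive (fun n => Re (a n))) t,
          PSeries (PS_derive (fun n => Im (a n))) t); split.
  - split; unfold CSeries, Re at 1, Im at 1; cbn [fst snd].
    + apply (is_derive_ext (PSeries (fun n => Re (a n)))); [|now apply is_derive_PSeries].
      intros x; apply Series_ext; intros n; symmetry; apply Hpow.
    + apply (is_derive_ext (PSeries (fun n => Im (a n)))); [|now apply is_derive_PSeries].
      intros x; apply Series_ext; intros n; symmetry; apply Hpow.
  - apply sums_to_parts; unfold Re at 2, Im at 2; cbn [fst snd]; split.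
    + apply (is_series_ext (fun k => (PS_derive (fun n => Re (a n)) k * t ^ k)%R)).
      * intros n; rewrite (proj1 (Hpow _ _ _)); unfold PS_derive; rewrite S_INR.
        destruct (a (S n)); unfold Re; simpl; ring.
      * apply real_series_inside; now rewrite CV_radius_derive.
    + apply (is_series_ext (fun k => (PS_derive (fun n => Im (a n)) k * t ^ k)%R)).
      * intros n; rewrite (proj2 (Hpow _ _ _)); unfold PS_derive; rewrite S_INR.
        destruct (a (S n)); unfold Im; simpl; ring.
      * apply real_series_inside; now rewrite CV_radius_derive.
Qed.

(** Let f(t) be the series at t z.  Its recurrence gives
    (1 - t z) f' = s z f on [0, 1], so the product of f with the power of
    1 - t z with exponent s has derivative 0; at t = 0 it is 1. *)
Lemma binomial_series (s z : C) :
  (Cmod z <= 1 / 4)%R ->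
  sums_to (fun j => bcoef s j * z ^ j) (Cpower (1 - z) (- s)).
Proof.
  intros Hz; destruct (exists_nat_ge (Cmod s)) as [d Hd].
  set (a := fun j => bcoef s j * z ^ j).
  assert (Ha : forall n, (Cmod (a n) <= 2 ^ d * (1 / 2) ^ n)%R).
  { intros n; unfold a; rewrite Cmod_mult, Cmod_pow.
    apply Rle_trans with (2 ^ (d + n) * (1 / 4) ^ n)%R.
    - apply Rmult_le_compat; try apply pow_le; try apply Cmod_ge_0.
      + now apply bcoef_bound.
      + apply pow_incr; split; [apply Cmod_ge_0|assumption].
    - rewrite pow_add, Rmult_assoc, <- Rpow_mult_distr.
      replace (2 * (1 / 4))%R with (1 / 2)%R by field; apply Rle_refl. }
  set (f := fun t : R => CSeries (fun j => a j * RtoC t ^ j)).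
  assert (Hf : forall t, (0 <= t <= 1)%R -> sums_to (fun j => a j * RtoC t ^ j) (f t)).
  { intros t Ht; apply (sums_to_of_bound _ (2 ^ d) (1 / 2)); [lra|]; intros n.
    rewrite Cmod_mult, Cmod_pow, Cmod_R, Rabs_pos_eq by lra.
    eapply Rle_trans; [apply Rmult_le_compat; [apply Cmod_ge_0|apply pow_le; lra|apply Ha|]|].
    - apply (pow_incr t 1); lra.
    - rewrite pow1; lra. }
  assert (Hre : forall t, (0 <= t <= 1)%R -> (0 < 1 - t * Re z)%R).
  { intros t Ht; assert (H := re_le_Cmod z).
    assert (H1 : (t * Re z <= 1 * (1 / 4))%R); [|lra].
    apply Rle_trans with (t * (1 / 4))%R.
    - apply Rmult_le_compat_l; [lra|]; assert (H2 := Rle_abs (Re z)); lra.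
    - apply Rmult_le_compat_r; lra. }
  assert (Hne : forall t, (0 <= t <= 1)%R -> 1 - RtoC t * z <> 0).
  { intros t Ht H; apply (f_equal Re) in H; specialize (Hre t Ht).
    destruct z; unfold Re in *; simpl in *; lra. }
  assert (Hder : forall t, (0 <= t <= 1)%R -> has_deriv f t (s * z * f t / (1 - RtoC t * z))).
  { intros t Ht.
    destruct (power_series_deriv a (2 ^ d) t Ha) as [df [Hdf Hs]];
      [rewrite Rabs_pos_eq; lra|].
    replace (s * z * f t / (1 - RtoC t * z)) with df; [exact Hdf|].
    (* The recurrence (j + 1) a_(j+1) = z (s + j) a_j, summed after multiplication
       by t^j; the part with j a_j is t df. *)
    assert (E : df = s * z * f t + z * (t * df)).
    { apply (sums_to_unique _ _ _ Hs).
      apply (sums_to_ext (fun j => s * z * (a j * RtoC t ^ j)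
        + z * (match j with O => 0 | S i => t * ((INR i + 1) * a (S i) * RtoC t ^ i) end))).
      - intros [|j]; unfold a.
        + assert (E := bcoef_S s O); simpl INR in *.
          rewrite !Cpow_S.
          replace (bcoef s 1) with ((0 + 1) * bcoef s 1) by ring; rewrite E; simpl; ring.
        + rewrite INR_S.
          assert (E := bcoef_S s (S j)); rewrite INR_S in E.
          transitivity (z ^ S (S j) * RtoC t ^ S j * ((INR j + 1 + 1) * bcoef s (S (S j))));
            [rewrite E, !Cpow_S|]; ring.
      - apply sums_to_plus; apply sums_to_scal; [now apply Hf|].
        apply sums_to_shift, sums_to_scal, Hs. }
    apply (Cmult_reg (1 - RtoC t * z)); [now apply Hne|].
    transitivity (df - z * (t * df)); [ring|rewrite E at 1].
    field; now apply Hne. }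
  set (g := fun t : R => f t * Cexp (s * Clog (1 - RtoC t * z))).
  assert (Hg : forall t, (0 <= t <= 1)%R -> has_deriv g t 0).
  { intros t Ht.
    assert (HE := deriv_Cexp _ _ _ (deriv_scal s _ _ _ (deriv_Clog z t (Hre t Ht)))).
    assert (H := deriv_mult _ _ _ _ _ (Hder t Ht) HE).
    replace (RtoC 0) with (s * z * f t / (1 - t * z) * Cexp (s * Clog (1 - t * z)) +
      f t * (s * (- z / (1 - t * z)) * Cexp (s * Clog (1 - t * z))));
      [exact H|field; now apply Hne]. }
  assert (Hconst : g 0%R = g 1%R).
  { apply injective_projections.
    - apply (eq_is_derive (fun t => Re (g t)) 0 1); [intros t Ht; apply (Hg t Ht)|lra].
    - apply (eq_is_derive (fun t => Im (g t)) 0 1); [intros t Ht; apply (Hg t Ht)|lra]. }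
  assert (Hf0 : f 0%R = 1).
  { apply (sums_to_unique _ _ _ (Hf 0%R ltac:(lra))).
    intros eps He; exists O; intros n _.
    replace (sum_n (fun j => a j * RtoC 0 ^ j) n) with (RtoC 1).
    - replace (1 - 1) with (RtoC 0) by ring; now rewrite Cmod_0.
    - induction n as [|n IH].
      + rewrite sum_O; unfold a, bcoef; simpl; as_C; field; apply C1_nz.
      + rewrite csum_Sn, <- IH, Cpow_S; cring. }
  unfold g in Hconst; rewrite Hf0 in Hconst.
  replace (1 - 0 * z) with (RtoC 1) in Hconst by ring.
  rewrite Clog_1, Cmult_0_r, Cexp_0, Cmult_1_r, !Cmult_1_l in Hconst.
  replace (Cpower (1 - z) (- s)) with (f 1%R).
  - apply (sums_to_ext (fun j => a j * RtoC 1 ^ j)); [|apply Hf; lra].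
    intros j; rewrite Cpow_1_l; unfold a; ring.
  - unfold Cpower.
    transitivity (f 1%R * (Cexp (s * Clog (1 - z)) * Cexp (- s * Clog (1 - z)))).
    + rewrite <- Cexp_add; replace (s * Clog (1 - z) + - s * Clog (1 - z)) with (RtoC 0) by ring.
      rewrite Cexp_0; ring.
    + rewrite Cmult_assoc, <- Hconst; ring.
Qed.

(** * Pfaff's transformation *)

(** The coefficients of 1F1(D; E; - x). *)
Definition hyp1F1_neg (D E : C) : fps :=
  fun i => (-1) ^ i * (poch D i / (poch E i * INR (fact i))).

Definition exp_fps : fps := fun i => / INR (fact i).

Arguments hyp1F1_neg (D E)%_C_scope.

(** The Chu-Vandermonde sum, written as Kummer's identity
    1F1(D; E; - x) exp(x) = 1F1(E - D; E; x).  The Leibniz rule for [theta]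
    expresses the coefficient n + 1 through two coefficients of index n. *)
Lemma vandermonde n : forall D E : C, (forall i, E + INR i <> 0) ->
  (hyp1F1_neg D E * exp_fps)%fps n
  = poch (E - D) n / (poch E n * INR (fact n)).
Proof.
  induction n as [|n IH]; intros D E HE.
  - rewrite fmul_0; unfold hyp1F1_neg, exp_fps; simpl; field; apply C1_nz.
  - set (h := hyp1F1_neg) in *; set (e := exp_fps) in *.
    assert (HE0 : E <> 0) by (specialize (HE O); simpl in HE; now rewrite Cplus_0_r in HE).
    assert (HE1 : forall i, E + 1 + INR i <> 0).
    { intros i; replace (E + 1 + INR i) with (E + INR (S i)) by (rewrite INR_S; ring); apply HE. }
    assert (Th : theta (h D E) = (cst (- (D / E)) * (X * h (D + 1)%C (E + 1)%C))%fps).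
    { apply functional_extensionality; intros i; rewrite cst_mul_at.
      unfold theta; destruct i as [|i]; [rewrite X_mul_0; simpl; ring|].
      rewrite X_mul_S; unfold h, hyp1F1_neg; rewrite !poch_S_left, fact_S_C, INR_S, Cpow_S.
      assert (H1 : poch (E + 1) i <> 0) by (apply poch_neq_0; auto).
      field; repeat split; auto using fact_neq_0_C, INR_S_neq_0. }
    assert (Te : theta e = (X * e)%fps).
    { apply functional_extensionality; intros i.
      unfold theta; destruct i as [|i]; [rewrite X_mul_0; simpl; ring|].
      rewrite X_mul_S; unfold e, exp_fps; rewrite fact_S_C, INR_S.
      field; auto using fact_neq_0_C, INR_S_neq_0. }
    assert (T := theta_mul (h D E) e); rewrite Th, Te in T.
    replace (cst (- (D / E)) * (X * h (D + 1)%C (E + 1)%C) * e + h D E * (X * e))%fps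
      with (X * (cst (- (D / E)) * (h (D + 1)%C (E + 1)%C * e) + h D E * e))%fps in T by ring.
    apply (f_equal (fun u : fps => u (S n))) in T; rewrite X_mul_S in T.
    unfold theta in T; unfold fadd in T; rewrite cst_mul_at in T.
    rewrite (IH D E HE), (IH (D + 1) (E + 1) HE1) in T.
    replace (E + 1 - (D + 1)) with (E - D) in T by ring.
    rewrite INR_S in T.
    assert (HP : poch E n <> 0) by (apply poch_neq_0; auto).
    assert (HP1 : poch (E + 1) n <> 0) by (apply poch_neq_0; auto).
    assert (HS : poch E n * (E + INR n) = E * poch (E + 1) n) by now rewrite <- poch_S_left.
    assert (HEn := HE n).
    apply (Cmult_reg (INR n + 1)); [apply INR_S_neq_0|]; rewrite T; cbn [poch]; rewrite fact_S_C.
    replace (poch (E + 1) n) with (poch E n * (E + INR n) / E) by (rewrite HS; field; assumption).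
    field; repeat split; auto using fact_neq_0_C, INR_S_neq_0.
Qed.

Lemma Cpower_sub_nat (z s : C) n :
  (0 < Re (1 - z))%R -> Cpower (1 - z) (- (s + INR n)) = Cpower (1 - z) (- s) * (/ (1 - z)) ^ n.
Proof.
  intros Hz.
  assert (Hne : 1 - z <> 0) by (intros H; rewrite H in Hz; simpl in Hz; lra).
  assert (H : Cexp (- Clog (1 - z)) = / (1 - z)).
  { apply (Cmult_reg (1 - z)); [assumption|].
    rewrite <- (Cexp_Clog (1 - z) Hz) at 1; rewrite <- Cexp_add.
    replace (Clog (1 - z) + - Clog (1 - z)) with (RtoC 0) by ring.
    rewrite Cexp_0; field; assumption. }
  unfold Cpower; induction n as [|n IH].
  - simpl; rewrite Cplus_0_r; ring.
  - rewrite INR_S, Cpow_S.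
    replace (- (s + (INR n + 1)) * Clog (1 - z))
      with (- (s + INR n) * Clog (1 - z) + - Clog (1 - z)) by ring.
    rewrite Cexp_add, IH, H; ring.
Qed.

Lemma small_disc (z : C) : (Cmod z <= 1 / 4)%R ->
  (0 < Re (1 - z))%R /\ (Cmod (z / (z - 1))%C <= 2 * Cmod z)%R.
Proof.
  intros Hz; assert (H := re_le_Cmod z); assert (H1 := Rle_abs (Re z)).
  assert (Hre : (0 < Re (1 - z))%R).
  { replace (Re (1 - z)) with (1 - Re z)%R by (destruct z; reflexivity); lra. }
  assert (Hne : z - 1 <> 0).
  { intros E; replace (1 - z) with (- (z - 1)) in Hre by ring.
    rewrite E in Hre; simpl in Hre; lra. }
  split; [assumption|].
  assert (Hd : (1 / 2 <= Cmod (z - 1)%C)%R).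
  { assert (T := Cmod_triangle (z - 1) (- z)).
    replace (z - 1 + - z) with (- (1)) in T by ring.
    rewrite Cmod_m1, Cmod_opp in T; lra. }
  rewrite Cmod_div by assumption.
  apply Rmult_le_reg_r with (Cmod (z - 1)%C); [lra|].
  unfold Rdiv; rewrite Rmult_assoc, Rinv_l, Rmult_1_r by lra.
  assert (H0 := Rmult_le_compat_l _ _ _ (Cmod_ge_0 z) Hd); lra.
Qed.

(** Expanding each (1 - z)^(- A - i) in the sum of
    h_i (- z)^i (1 - z)^(- A - i) gives a double series whose rows sum to the left
    side and whose antidiagonals are, by Chu-Vandermonde, the terms of the right
    side. *)
Lemma pfaff (A B D : C) :
  (forall n, (1 / 2 <= Cmod (D + INR n)%C)%R) ->
  exists r, (0 < r)%R /\ forall z, (Cmod z <= r)%R ->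
    evaluates_to (z / (z - 1)) (hcoef A (D - B) D) (hyp2F1 A (D - B) D (z / (z - 1)))
    /\ Cpower (1 - z) (- A) * hyp2F1 A (D - B) D (z / (z - 1)) = hyp2F1 A B D z.
Proof.
  intros HD.
  assert (HD0 : forall i, D + INR i <> 0)
    by (intros i H; specialize (HD i); rewrite H, Cmod_0 in HD; lra).
  destruct (hcoef_bound A (D - B) D HD) as [rho [Hrho Hh]].
  destruct (exists_nat_ge (Cmod A)) as [d Hd].
  exists (/ (8 * rho))%R; split; [apply Rinv_0_lt_compat; lra|].
  intros z Hz.
  assert (Hz8 : (rho * Cmod z <= 1 / 8)%R).
  { apply Rmult_le_compat_l with (r := rho) in Hz; [|lra].
    replace (rho * / (8 * rho))%R with (1 / 8)%R in Hz by (field; lra); assumption. }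
  assert (Hz0 := Cmod_ge_0 z).
  assert (Hz1 : (Cmod z <= 1 / 8)%R).
  { assert (H := Rmult_le_compat_r _ _ _ Hz0 Hrho); lra. }
  destruct (small_disc z ltac:(lra)) as [Hre Hx].
  set (x := z / (z - 1)) in *.
  assert (Hne : 1 - z <> 0) by (intros H; rewrite H in Hre; simpl in Hre; lra).
  assert (HE : evaluates_to x (hcoef A (D - B) D) (hyp2F1 A (D - B) D x)).
  { apply (eval_hyp2F1 _ _ _ rho); try assumption.
    apply Rle_trans with (rho * (2 * Cmod z))%R; [apply Rmult_le_compat_l; lra|lra]. }
  split; [exact HE|].
  set (u := fun i j => hcoef A (D - B) D i * (- z) ^ i * (bcoef (A + INR i) j * z ^ j)).
  symmetry; unfold hyp2F1 at 1; apply sums_to_CSeries.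
  apply (sums_to_ext (fun n => sum_n (fun i => u i (n - i)%nat) n)).
  - intros n.
    transitivity (poch A n * z ^ n *
      (hyp1F1_neg (D - B) D * exp_fps)%fps n).
    + unfold fmul; rewrite <- csum_mult_l; apply sum_n_ext_loc; intros i Hi; unfold u.
      assert (En : n = (i + (n - i))%nat) by lia.
      replace (poch A n) with (poch A i * poch (A + INR i) (n - i))
        by (rewrite <- poch_add; f_equal; lia).
      replace (z ^ n) with (z ^ i * z ^ (n - i)) by (rewrite <- Cpow_add_r; f_equal; lia).
      replace (- z) with (-1 * z) by ring; rewrite Cpow_mult_l.
      unfold hyp1F1_neg, exp_fps, hcoef, bcoef, Cdiv; cring.
    + rewrite vandermonde by assumption.
      replace (D - (D - B)) with B by ring; unfold Cdiv; ring.
  - apply (sums_to_diagonal u (fun i => Cpower (1 - z) (- A) * (hcoef A (D - B) D i * x ^ i))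
      _ (2 ^ d) (1 / 4)).
    + lra.
    + intros i j; unfold u; rewrite !Cmod_mult, !Cmod_pow, Cmod_opp.
      apply Rle_trans with (rho ^ i * Cmod z ^ i * (2 ^ (d + i + j) * Cmod z ^ j))%R.
      * repeat apply Rmult_le_compat; repeat apply Rmult_le_pos;
          try apply pow_le; try apply Cmod_ge_0; try apply Rle_refl; try apply Hh.
        apply bcoef_bound; eapply Rle_trans; [apply Cmod_triangle|].
        rewrite Cmod_R, Rabs_pos_eq by apply pos_INR; rewrite plus_INR; lra.
      * apply Rle_trans with (2 ^ d * ((2 * (rho * Cmod z)) ^ i * (2 * Cmod z) ^ j))%R.
        -- apply Req_le; rewrite !Rpow_mult_distr, !pow_add; ring.
        -- assert (Hpos : (0 <= rho * Cmod z)%R) by (apply Rmult_le_pos; lra).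
           apply Rmult_le_compat_l; [apply pow_le; lra|]; rewrite pow_add.
           apply Rmult_le_compat; try (apply pow_le; lra).
           ++ apply pow_incr; lra.
           ++ apply pow_incr; lra.
    + intros i.
      replace (Cpower (1 - z) (- A) * (hcoef A (D - B) D i * x ^ i))
        with (hcoef A (D - B) D i * (- z) ^ i * Cpower (1 - z) (- (A + INR i))).
      * apply sums_to_scal, binomial_series; lra.
      * rewrite Cpower_sub_nat by assumption.
        replace x with (- z * / (1 - z)).
        -- rewrite Cpow_mult_l; ring.
        -- unfold x; field; split; [|assumption].
           intros H; apply Hne; replace (1 - z) with (- (z - 1)) by ring; rewrite H; ring.
    + apply sums_to_scal, HE.
Qed.

(** * The identity *)

(** The denominator parameters of both Gauss functions are half-integers; this is
    the lower bound which [pfaff] asks for. *)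
Lemma half_int_bound (n : Z) : (1 / 2 <= Cmod (1 / 2 + IZR n)%C)%R.
Proof.
  replace (1 / 2 + IZR n) with (RtoC (1 / 2 + IZR n))
    by (rewrite RtoC_plus, RtoC_div; [reflexivity|lra]).
  rewrite Cmod_R.
  destruct (Z.le_gt_cases 0 n) as [Hn|Hn].
  - apply IZR_le in Hn; rewrite Rabs_pos_eq; lra.
  - assert (H : (IZR n <= -1)%R) by (apply (IZR_le n (-1)); lia).
    rewrite Rabs_left; lra.
Qed.

Theorem theorem3p2 (a : C) (ha : forall n : Z, a <> IZR n) (k l : nat) :
  exists r : R, (0 < r)%R /\
  forall z : C, (Cmod z < r)%R ->
    Cpower (1 - z) (- a)
    * F211_terminating a (- a - 2 * INR k - 2 * INR l) (1 / 2 - INR k - INR l)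
        k l (z / (z - 1)) (1 / (1 - z))
    =
    poch ((a + 1) / 2) l * poch ((a + 1) / 2 + INR k) l
    / (poch (1 / 2) l * poch (INR k + 1 / 2) l)
    * hyp2F1 (a / 2) ((a + 1) / 2 + INR l) (1 / 2 - INR k) z ^ 2
    -
    poch ((a + 1) / 2) k * poch ((a + 1) / 2 + INR l) k
    * poch (a / 2) (k + l + 1) ^ 2
    / (poch (1 / 2) k * poch (1 / 2) (k + 1) ^ 2 * poch (1 / 2) l
       * poch (1 / 2) (k + l))
    * z ^ (2 * k + 1)
    * hyp2F1 ((a + 1) / 2 + INR k) (a / 2 + INR k + INR l + 1) (3 / 2 + INR k) z ^ 2.
Proof.
  destruct (pfaff (a / 2) ((a + 1) / 2 + INR l) (1 / 2 - INR k)) as [r1 [Hr1 H1]].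
  { intros n; replace (1 / 2 - INR k + INR n) with (1 / 2 + IZR (Z.of_nat n - Z.of_nat k)).
    - apply half_int_bound.
    - rewrite minus_IZR, <- !INR_IZR_INZ, RtoC_minus; ring. }
  destruct (pfaff ((a + 1) / 2 + INR k) (a / 2 + INR k + INR l + 1) (3 / 2 + INR k))
    as [r2 [Hr2 H2]].
  { intros n; replace (3 / 2 + INR k + INR n) with (1 / 2 + IZR (1 + Z.of_nat k + Z.of_nat n)).
    - apply half_int_bound.
    - rewrite !plus_IZR, <- !INR_IZR_INZ, !RtoC_plus; field. }
  exists (Rmin (1 / 4) (Rmin r1 r2)); split; [repeat apply Rmin_glb_lt; lra|].
  intros z Hz.
  assert (M1 := Rmin_l (1 / 4) (Rmin r1 r2)); assert (M2 := Rmin_r (1 / 4) (Rmin r1 r2)).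
  assert (M3 := Rmin_l r1 r2); assert (M4 := Rmin_r r1 r2).
  destruct (H1 z ltac:(lra)) as [EF PF]; destruct (H2 z ltac:(lra)) as [EG PG].
  destruct (small_disc z ltac:(lra)) as [Hre _].
  clear H1 H2.
  assert (Hne : 1 - z <> 0) by (intros H; rewrite H in Hre; simpl in Hre; lra).
  assert (Hne' : z - 1 <> 0).
  { intros H; apply Hne; replace (1 - z) with (- (z - 1)) by ring; rewrite H; ring. }
  set (x := z / (z - 1)) in *.
  set (b := - a - 2 * INR k - 2 * INR l); set (c := 1 / 2 - INR k - INR l).
  assert (Hc : forall i, c + INR i <> 0)
    by (intros i; apply central_denominator_neq_0).
  assert (EP := eval_F211 a b c x k l Hc).
  replace (1 - x) with (1 / (1 - z)) in EP by (unfold x; field; now split).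
  assert (Haa : a / 2 + a / 2 = a) by field.
  assert (Hsq := F211_fps_squares (a / 2) b c k l (alpha a k l) (beta a k l)).
  rewrite Haa in Hsq.
  specialize (Hsq eq_refl eq_refl).
  specialize (Hsq (eq_trans (F211_fps_0 a b c k l) (watson a l k)) (alpha_neq_0 a k l ha)
    (alpha_beta a b c k l eq_refl eq_refl)); cbv zeta in Hsq.
  replace (1 / 2 - INR k - ((a + 1) / 2 + INR l)) with (- (a / 2) - INR k - INR l) in EF, PF by field.
  replace (3 / 2 + INR k - (a / 2 + INR k + INR l + 1)) with (1 / 2 - a / 2 - INR l) in EG, PG by field.
  replace (a / 2 + (1 / 2 + INR k)) with ((a + 1) / 2 + INR k) in Hsq by field.
  rewrite Hsq in EP.
  assert (ER := eval_add _ _ _ _ _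
    (eval_mul _ _ _ _ _ (eval_cst x (alpha a k l)) (eval_mul _ _ _ _ _ EF EF))
    (eval_mul _ _ _ _ _ (eval_cst x (beta a k l)) (eval_mul _ _ _ _ _
      (eval_pow _ _ _ (2 * k + 1) (eval_X x)) (eval_mul _ _ _ _ _ EG EG)))).
  rewrite (eval_unique _ _ _ _ EP ER), <- PF, <- PG.
  fold (alpha a k l) (beta a k l).
  set (F := hyp2F1 _ _ _ x); set (G := hyp2F1 _ _ _ x).
  assert (HP : forall s t, Cpower (1 - z) (- (s + t)) = Cpower (1 - z) (- s) * Cpower (1 - z) (- t)).
  { intros s t; unfold Cpower; rewrite <- Cexp_add; f_equal; ring. }
  assert (E1 : Cpower (1 - z) (- a) = Cpower (1 - z) (- (a / 2)) ^ 2)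
    by (rewrite <- Haa at 1; rewrite HP; ring).
  assert (E2 : x ^ (2 * k + 1) * Cpower (1 - z) (- a)
    = - (z ^ (2 * k + 1) * Cpower (1 - z) (- ((a + 1) / 2 + INR k)) ^ 2)).
  { assert (E : Cpower (1 - z) (- ((a + 1) / 2 + INR k)) ^ 2
      = Cpower (1 - z) (- a) * (/ (1 - z)) ^ (2 * k + 1)).
    { rewrite <- Cpower_sub_nat by assumption.
      transitivity (Cpower (1 - z) (- ((a + 1) / 2 + INR k)) * Cpower (1 - z) (- ((a + 1) / 2 + INR k)));
        [ring|].
      rewrite <- HP; f_equal; rewrite INR_add, <- INR_double; simpl INR; field. }
    rewrite E; replace x with (-1 * (z * / (1 - z))) by (unfold x; field; now split).
    rewrite !Cpow_mult_l.
    replace ((-1) ^ (2 * k + 1)) with (RtoC (-1)); [ring|].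
    rewrite Cpow_add_r, Cpow_1_r, Cpow_mult_r.
    replace ((-1) ^ 2) with (RtoC 1) by ring; rewrite Cpow_1_l; ring. }
  transitivity (alpha a k l * (Cpower (1 - z) (- a) * F ^ 2)
    + beta a k l * (x ^ (2 * k + 1) * Cpower (1 - z) (- a)) * G ^ 2); [ring|].
  rewrite E2, E1; ring.
Qed.
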